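(* Let $R$ be a principal ideal domain of characteristic different from $2$, let $\Delta\in R$ be nonzero, and let $H_0$ be the set of values of the principal form class in $(R/\Delta R)^\times$. The map $\psi\colon \mathrm{Cl}^{tw}_R(\Delta)\to (R/\Delta R)^\times/H_0$ sending the class of a form $q$ to its set of values $H_q$ in $(R/\Delta R)^\times$ modulo $H_0$ is well-defined and is a group homomorphism. Its kernel contains the subgroup of squares $\mathrm{Cl}^{tw}_R(\Delta)^\square$, so it factors through a homomorphism $\Psi\colon \mathrm{Cl}^{tw}_R(\Delta)/\mathrm{Cl}^{tw}_R(\Delta)^\square\to(R/\Delta R)^\times/H_0$.
   Context: Forms $[a,b,c]:=ax^2+bxy+cy^2$ over $R$, primitive if $\langle a,b,c\rangle=R$, discriminant $b^2-4ac$. Twisted action of $M=\begin{pmatrix}\alpha&\beta\\ \gamma&\delta\end{pmatrix}\in\mathrm{GL}_2(R)$: $(M\cdot q)(x,y):=\frac{1}{\alpha\delta-\beta\gamma}q(\alpha x+\beta y,\gamma x+\delta y)$. $\mathrm{Cl}^{tw}_R(\Delta)$ is the set of orbits of primitive forms of discriminant $\Delta$; when nonempty, fix $\pi\in R$ with $\Delta\equiv\pi^2\pmod{4R}$ (unique mod $2R$). The map sending the class of $[a,b,c]$ with $a\ne0$ (every class has such a representative) to the class of $\langle\omega+\frac{\pi-b}{2},a\rangle$ in $\mathrm{Pic}(R[\omega]/\langle\omega^2+\pi\omega-\frac{\Delta-\pi^2}{4}\rangle)$ is a bijection, and $\mathrm{Cl}^{tw}_R(\Delta)$ carries the transported group structure.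 The principal form class (neutral element) is the class of $[1,\pi,-\frac{\Delta-\pi^2}{4}]$. For a primitive form $q$, $\mathrm{val}_\Delta(q):=\{q(x,y):x,y\in R/\Delta R\}\cap(R/\Delta R)^\times$, and $H_q:=\bigcup_{q'\sim q}\mathrm{val}_\Delta(q')$; $H_0$ is $H_q$ for $q$ in the principal class. *)

(* Defs.v *)
From HB Require Import structures.
From mathcomp Require Import all_boot all_order all_algebra.
From mathcomp Require Import boolp classical_sets.

Set Implicit Arguments.
Unset Strict Implicit.
Unset Printing Implicit Defensive.

Import GRing.Theory.

Local Open Scope classical_set_scope.
Local Open Scope ring_scope.
Local Open Scope quotient_scope.

Definition is_ideal (R : comNzRingType) (I : set R) : Prop :=
  [/\ I 0, forall x y, I x -> I y -> I (x + y) & forall a x, I x -> I (a * x)].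

Definition is_pid (R : idomainType) : Prop :=
  forall I : set R, is_ideal I -> exists d, I = [set a * d | a in [set: R]].

(* The solution z of x = y * z: unique when it exists and y != 0, which is the
   only case where [exquo] is used; arbitrary if x is not a multiple of y. *)
Definition exquo (R : idomainType) (x y : R) : R :=
  xget 0 [set z | x = y * z].

(** * Groups and their quotients *)

Section Quotients.
Context {G : magmaType}.
Local Open Scope group_scope.

Definition abelian_group_law (e : G) : Prop :=
  [/\ forall x y z : G, x * (y * z) = x * y * z, forall x y : G, x * y = y * x,
      forall x : G, e * x = x & forall x : G, exists y, y * x = e].

Definition is_subgroup (e : G) (H : set G) : Prop :=
  [/\ H e, forall x y, H x -> H y -> H (x * y)
    & forall x, H x -> exists2 y, H y & y * x = e].

Definition coset_set (H : set G) (x : G) : set G := [set x * h | h in H].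

(* G / H as the set of cosets x * H.  The product of two cosets is the coset of
   the product of representatives; this is independent of their choice when H
   is a subgroup of an abelian group G. *)
Record quotg (H : set G) :=
  Quotg { quotg_set :> set G; _ : exists x, quotg_set = coset_set H x }.

Lemma quotg_subproof (H : set G) (A : quotg H) :
  exists x, quotg_set A = coset_set H x.
Proof. by case: A. Qed.

Definition coset_proj (H : set G) (x : G) : quotg H :=
  @Quotg H (coset_set H x) (ex_intro _ x erefl).

Definition quotg_repr (H : set G) (A : quotg H) : G :=
  sval (cid (quotg_subproof A)).

HB.instance Definition _ (H : set G) := hasMul.Build (quotg H)
  (fun A B => coset_proj H (quotg_repr A * quotg_repr B)).

Definition squares : set G := [set x * x | x in [set: G]].

End Quotients.

Notation "G '//g' H" := (@quotg G H) (at level 40, H at level 39).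

(** * The unit group of a ring, the zero ring included *)

Section Units.
Variable A : comPzRingType.

Definition is_unit (x : A) : bool := `[< exists y, y * x = 1 >].

Record units := Units { units_val :> A; _ : is_unit units_val }.

HB.instance Definition _ := [isSub for units_val].
HB.instance Definition _ := [Choice of units by <:].

Lemma is_unit1 : is_unit 1.
Proof. by apply/asboolP; exists 1; rewrite mul1r. Qed.

Lemma is_unitM (x y : units) : is_unit (val x * val y).
Proof.
case: x y => x /asboolP[x' x'x] [y /asboolP[y' y'y]] /=; apply/asboolP.
by exists (x' * y'); rewrite mulrACA x'x y'y mul1r.
Qed.

Definition unit_inv (x : units) : A := sval (cid (asboolW (valP x))).

Lemma unit_invP (x : units) : unit_inv x * val x = 1.
Proof. by rewrite /unit_inv; case: cid. Qed.

Lemma is_unitV (x : units) : is_unit (unit_inv x).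
Proof. by apply/asboolP; exists (val x); rewrite mulrC unit_invP. Qed.

Definition units1 := Units is_unit1.
Definition unitsM x y := Units (is_unitM x y).
Definition unitsV x := Units (is_unitV x).

Lemma unitsMA : associative unitsM.
Proof. by move=> x y z; apply/val_inj; rewrite /= mulrA. Qed.

Lemma units1M : left_id units1 unitsM.
Proof. by move=> x; apply/val_inj; rewrite /= mul1r. Qed.

Lemma unitsM1 : right_id units1 unitsM.
Proof. by move=> x; apply/val_inj; rewrite /= mulr1. Qed.

Lemma unitsVM : left_inverse units1 unitsV unitsM.
Proof. by move=> x; apply/val_inj; exact: unit_invP. Qed.

Lemma unitsMV : right_inverse units1 unitsV unitsM.
Proof. by move=> x; apply/val_inj; rewrite /= mulrC; exact: unit_invP. Qed.

HB.instance Definition _ :=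
  isGroup.Build units unitsMA units1M unitsM1 unitsVM unitsMV.

End Units.

(** * The residue ring R / Delta R *)

(* [{ideal_quot _}] is restricted to proper ideals, whereas Delta may be a unit;
   hence a ring structure in which 1 = 0 is allowed, on top of [Quotient.quot]. *)
Section Residues.
Variables (R : comNzRingType) (Delta : R).

Definition multiples : {pred R} := fun x => `[< exists a, x = a * Delta >].

Lemma multiples_zmod_closed : zmod_closed multiples.
Proof.
split=> [|x y /asboolP[a ->] /asboolP[b ->]]; apply/asboolP.
  by exists 0; rewrite mul0r.
by exists (a - b); rewrite mulrBl.
Qed.

HB.instance Definition _ :=
  GRing.isZmodClosed.Build R multiples multiples_zmod_closed.

Definition residue := Quotient.quot multiples.

HB.instance Definition _ := GRing.Zmodule.on residue.
HB.instance Definition _ := EqQuotient.on residue.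

Definition residue_mul := lift_op2 residue *%R.

Lemma residue_eqP (x y : R) :
  (exists a, x - y = a * Delta) <-> \pi_residue x = \pi_residue y.
Proof.
split=> [h|/eqP]; first by apply/eqP; rewrite -Quotient.idealrBE; apply/asboolP.
by rewrite -Quotient.idealrBE => /asboolP.
Qed.

Lemma pi_residueM (x y : R) :
  \pi_residue (x * y) = residue_mul (\pi_residue x) (\pi_residue y).
Proof.
unlock residue_mul; have /residue_eqP[a ha] := esym (reprK (\pi_residue x)).
have /residue_eqP[b hb] := esym (reprK (\pi_residue y)).
apply/residue_eqP; exists (a * y + repr (\pi_residue x) * b).
by rewrite mulrDl mulrAC -ha -mulrA -hb mulrBl mulrBr addrA subrK.
Qed.

Lemma residue_mulA : associative residue_mul.
Proof.
move=> x y z; rewrite -[x]reprK -[y]reprK -[z]reprK.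
by rewrite -!pi_residueM mulrA.
Qed.

Lemma residue_mulC : commutative residue_mul.
Proof.
by move=> x y; rewrite -[x]reprK -[y]reprK -!pi_residueM mulrC.
Qed.

Lemma residue_mul1 : left_id (\pi_residue 1) residue_mul.
Proof. by move=> x; rewrite -[x]reprK -pi_residueM mul1r. Qed.

Lemma pi_residueD (x y : R) :
  \pi_residue (x + y) = \pi_residue x + \pi_residue y.
Proof. exact: Quotient.pi_add. Qed.

Lemma residue_mulDl : left_distributive residue_mul +%R.
Proof.
move=> x y z; rewrite -[x]reprK -[y]reprK -[z]reprK.
by rewrite -pi_residueD -!pi_residueM mulrDl pi_residueD.
Qed.

HB.instance Definition _ := GRing.Zmodule_isComPzRing.Build residue
  residue_mulA residue_mulC residue_mul1 residue_mulDl.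

End Residues.

(** * Products of isomorphism classes of modules *)

Section ModuleClasses.
Variable S : comNzRingType.

Definition mod_iso (M N : lmodType S) : Prop :=
  exists f : {linear M -> N}, bijective f.

Definition is_tensor (M N P : lmodType S) : Prop :=
  exists beta : {bilinear M -> N -> P},
  forall (Q : lmodType S) (gamma : {bilinear M -> N -> Q}),
  exists2 g : {linear P -> Q}, (forall m n, g (beta m n) = gamma m n)
    & forall g' : {linear P -> Q},
        (forall m n, g' (beta m n) = gamma m n) -> g' =1 g.

(* Classes of modules are plain predicates because [set] is too small, in the
   sense of universes, to be applied to [lmodType S]. *)
Definition mod_class (M : lmodType S) : lmodType S -> Prop :=
  fun N => mod_iso M N.

(* The group law of Pic S is the restriction of this product to the classes of
   invertible modules. *)
Definition pic_mul (C D : lmodType S -> Prop) : lmodType S -> Prop :=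
  fun P => exists M N, [/\ C M, D N & is_tensor M N P].

End ModuleClasses.

Section Span.
Variables (S : comNzRingType) (u v : S).

Definition span2_pred : {pred S^o} :=
  fun x => `[< exists a b, x = a * u + b * v >].

Lemma span2_closed : submod_closed span2_pred.
Proof.
split=> [|c x y /asboolP[a [b ->]] /asboolP[a' [b' ->]]]; apply/asboolP.
  by exists 0, 0; rewrite !mul0r addr0.
exists (c * a + a'), (c * b + b').
by rewrite -[c *: _]/(c * _) mulrDr !mulrDl !mulrA addrACA.
Qed.

HB.instance Definition _ :=
  GRing.isSubmodClosed.Build S S^o span2_pred span2_closed.

(* The ideal <u, v> as an S-module *)
Record span2 := Span2 { span2_val :> S^o; _ : span2_val \in span2_pred }.

HB.instance Definition _ := [isSub for span2_val].
HB.instance Definition _ := [Choice of span2 by <:].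
HB.instance Definition _ := [SubChoice_isSubLmodule of span2 by <:].

End Span.

(** * Binary quadratic forms *)

Record bqform (A : Type) := Form { fa : A; fb : A; fc : A }.

Definition feval (A : comPzRingType) (q : bqform A) (x y : A) : A :=
  fa q * x ^+ 2 + fb q * x * y + fc q * y ^+ 2.

Definition disc (A : comPzRingType) (q : bqform A) : A :=
  fb q ^+ 2 - 4 * fa q * fc q.

Definition primitive (A : comPzRingType) (q : bqform A) : Prop :=
  exists u v w, u * fa q + v * fb q + w * fc q = 1.

Definition map_form (A B : Type) (f : A -> B) (q : bqform A) : bqform B :=
  Form (f (fa q)) (f (fb q)) (f (fc q)).

Section TwistedClasses.
Variable R : idomainType.
Implicit Types (q : bqform R) (M : 'M[R]_2).

(* The coefficients of (\det M)^-1 * q(alpha x + beta y, gamma x + delta y),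
   where M is the matrix with rows (alpha, beta) and (gamma, delta). *)
Definition twist M q : bqform R :=
  let alpha := M 0 0 in let beta := M 0 1 in
  let gamma := M 1 0 in let delta := M 1 1 in
  Form ((\det M)^-1 * feval q alpha gamma)
       ((\det M)^-1 * (2 * fa q * alpha * beta
          + fb q * (alpha * delta + beta * gamma) + 2 * fc q * gamma * delta))
       ((\det M)^-1 * feval q beta delta).

Definition tw_orbit q : set (bqform R) :=
  [set twist M q | M in [set M | M \in unitmx]].

Record pform (Delta : R) := Pform {
  pform_form :> bqform R;
  _ : primitive pform_form;
  _ : disc pform_form = Delta }.

(* [pi] only enters the group law given to [Cl_tw Delta pi] below. *)
Record Cl_tw (Delta pi : R) := ClTw {
  orb :> set (bqform R);
  _ : exists q : pform Delta, orb = tw_orbit q }.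

HB.instance Definition _ Delta pi := gen_eqMixin (Cl_tw Delta pi).
HB.instance Definition _ Delta pi := gen_choiceMixin (Cl_tw Delta pi).

Definition cls (Delta pi : R) (q : pform Delta) : Cl_tw Delta pi :=
  @ClTw Delta pi (tw_orbit q) (ex_intro _ q erefl).

Section GroupLaw.
Variables Delta pi : R.

Definition order_poly : {poly R} :=
  'X^2 + pi *: 'X - (exquo (Delta - pi ^+ 2) 4)%:P.

(* R[omega] / <omega^2 + pi omega - (Delta - pi^2) / 4> *)
Definition qorder := {poly %/ order_poly}.

Definition form_ideal q : lmodType qorder :=
  span2 ('qX + (exquo (pi - fb q) 2)%:A : qorder) ((fa q)%:A : qorder).

(* The class of <omega + (pi - b)/2, a> for any [a, b, c] in C with a != 0 *)
Definition to_pic (C : Cl_tw Delta pi) : lmodType qorder -> Prop :=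
  fun N => exists q, [/\ orb C q, fa q != 0 & mod_class (form_ideal q) N].

(* The law transported from Pic: over a principal ideal domain with 2 != 0,
   Delta != 0 and Delta = pi^2 mod 4, [to_pic] is a bijection onto Pic (qorder),
   so that E exists and is unique, and the default value C plays no role. *)
Definition cl_mul (C D : Cl_tw Delta pi) : Cl_tw Delta pi :=
  xget C [set E | to_pic E = pic_mul (to_pic C) (to_pic D)].

HB.instance Definition _ := hasMul.Build (Cl_tw Delta pi) cl_mul.

Definition principal_form : bqform R :=
  Form 1 pi (- exquo (Delta - pi ^+ 2) 4).

(** * Values modulo Delta *)

Definition values q : set (units (residue Delta)) :=
  [set u | exists x y, units_val u = feval (map_form \pi_(residue Delta) q) x y].

Definition H_ q : set (units (residue Delta)) :=
  \bigcup_(q' in tw_orbit q) values q'.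

End GroupLaw.
End TwistedClasses.

Arguments values {R} Delta q.
Arguments H_ {R} Delta q.

(* Main.v *)
(* Write [theta = omega + (pi - b) / 2], so that [theta ^ 2 + b theta + a c = 0]
   and the ideal of [a, b, c] is free over R on [a] and [- theta].  In these
   coordinates an isomorphism of ideals is a matrix of GL_2 (R), and linearity
   with respect to [omega] says that this matrix transforms one form into the
   other by the twisted action; hence [to_pic] is well defined and injective.
   If [a1, b, c1] and [a2, b, c2] have the same [b] and coprime [a1], [a2], then
   multiplication exhibits <theta, a1 a2> as the tensor product of
   <theta, a1> and <theta, a2>, so the product of the two classes is the class of
   [a1 a2, b, c].  Over a principal ideal domain finitely many classes have
   representatives with equal [b] and leading coefficients that are pairwise
   coprime and coprime to [Delta], which reduces the group axioms to the
   multiplication of leading coefficients.  Finally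
   [a q (x, y) = q0 (a x + (b - pi) / 2 y, y)] for the multiplicative norm form
   [q0], so that [H_q = a H_0] when [a] is prime to [Delta]: [psi] multiplies
   leading coefficients modulo [H_0], and [a ^ 2] is a value of [q0]. *)
From HB Require Import structures.
Require Import Defs.
From mathcomp Require Import all_boot all_order all_algebra ring.
From mathcomp Require Import boolp classical_sets.
Set Implicit Arguments.
Unset Strict Implicit.
Unset Printing Implicit Defensive.
Import GRing.Theory.
Local Open Scope classical_set_scope.
Local Open Scope ring_scope.

(** * Comaximal elements *)

Section Comaximal.
Variable R : idomainType.
Implicit Types (a b c d u x y : R).

Definition comax x y := exists u v, u * x + v * y = 1.

Definition divides d x := exists e, x = e * d.

Lemma comaxC x y : comax x y -> comax y x.
Proof. by move=> [u [v h]]; exists v, u; rewrite addrC. Qed.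

Lemma comaxM x y z : comax x z -> comax y z -> comax (x * y) z.
Proof.
move=> [u [v h]] [u' [v' h']]; exists (u * u'), (u * x * v' + v).
transitivity (u * x * (u' * y + v' * z) + v * z); first by ring.
by rewrite h' mulr1.
Qed.

Lemma comaxMr x y z : comax z x -> comax z y -> comax z (x * y).
Proof. by move=> /comaxC hx /comaxC hy; apply/comaxC/comaxM. Qed.

Lemma comax1 x : comax 1 x.
Proof. by exists 1, 0; rewrite mulr1 mul0r addr0. Qed.

Lemma comaxX x y n : comax x y -> comax (x ^+ n) y.
Proof.
move=> h; elim: n => [|n IH]; first by rewrite expr0; exact: comax1.
by rewrite exprS; exact: comaxM.
Qed.

Lemma comax_dvdl d x y : comax x y -> divides d x -> comax d y.
Proof. by move=> [u [v h]] [e def_x]; exists (u * e), v; rewrite -h def_x mulrA. Qed.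

Lemma comax_dvdr d x y : comax x y -> divides d y -> comax x d.
Proof. by move=> /comaxC h hd; apply/comaxC; apply: comax_dvdl hd. Qed.

Lemma comax_shift x y e : comax x y -> comax (x + e * y) y.
Proof. by move=> [u [v h]]; exists u, (v - u * e); rewrite -h; ring. Qed.

Lemma comax_unit d x : d \is a GRing.unit -> comax d x.
Proof. by move=> ud; exists d^-1, 0; rewrite mulVr // mul0r addr0. Qed.

Lemma dividesMl d x y : divides d x -> divides d (y * x).
Proof. by case=> e ->; exists (y * e); rewrite mulrA. Qed.

Lemma dividesD d x y : divides d x -> divides d y -> divides d (x + y).
Proof. by move=> [e ->] [f ->]; exists (e + f); rewrite mulrDl. Qed.

Lemma divides_trans d x y : divides d x -> divides x y -> divides d y.
Proof. by move=> [e ->] [f ->]; exists (f * e); rewrite mulrA. Qed.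

Lemma divides1_unit d : divides d 1 -> d \is a GRing.unit.
Proof. by move=> [e h]; apply/unitrP; exists e; rewrite -h mulrC -h. Qed.

Lemma unit_of_comax_dvd d x : comax d x -> divides d x -> d \is a GRing.unit.
Proof.
move=> [u [v h]] [e hx]; apply: divides1_unit; exists (u + v * e).
by rewrite -h hx; ring.
Qed.

Lemma gauss_comax x y z : comax x y -> divides x (y * z) -> divides x z.
Proof.
move=> [u [v h]] [e hyz]; exists (u * z + v * e).
by rewrite -{1}[z]mul1r -h mulrDl -mulrA -(mulrA v) hyz; ring.
Qed.

Lemma chinese_comax a b x y : comax a b ->
  exists z, divides a (z - x) /\ divides b (z - y).
Proof.
move=> [u [v h]]; exists (v * b * x + u * a * y); split.
  exists (u * (y - x)); rewrite -{2}[x]mul1r -h; ring.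
exists (v * (x - y)); rewrite -{2}[y]mul1r -h; ring.
Qed.

Hypothesis pidR : is_pid R.

Lemma pid_gcd x y : exists d,
  [/\ divides d x, divides d y & exists u v, u * x + v * y = d].
Proof.
have [|d hd] := pidR (I := [set z | exists u v, u * x + v * y = z]).
  split=> /=.
  - by exists 0, 0; rewrite !mul0r addr0.
  - move=> _ _ [u [v <-]] [u' [v' <-]].
    by exists (u + u'), (v + v'); ring.
  - by move=> c _ [u [v <-]]; exists (c * u), (c * v); ring.
exists d; split.
- have : [set z | exists u v, u * x + v * y = z] x.
    by exists 1, 0; rewrite mul1r mul0r addr0.
  by rewrite hd => -[e _ <-]; exists e.
- have : [set z | exists u v, u * x + v * y = z] y.
    by exists 0, 1; rewrite mul1r mul0r add0r.
  by rewrite hd => -[e _ <-]; exists e.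
- have : [set a * d | a in [set: R]] d by exists 1; rewrite ?mul1r.
  by rewrite -hd.
Qed.

(* [t] generates the saturation {x | N divides x * a ^+ k for some k}. *)
Lemma saturate N a : N != 0 ->
  exists t g k, [/\ N = t * g, divides g (a ^+ k) & comax a t].
Proof.
move=> N0; have [|t ht] := pidR (I := [set x | exists k, divides N (x * a ^+ k)]).
  split=> /=.
  - by exists 0, 0; rewrite !mul0r.
  - move=> x y [k hx] [l hy]; exists (k + l)%N; rewrite exprD.
    have -> : (x + y) * (a ^+ k * a ^+ l) =
      a ^+ l * (x * a ^+ k) + a ^+ k * (y * a ^+ l) by ring.
    by apply: dividesD; apply: dividesMl.
  - by move=> c x [k hx]; exists k; rewrite -mulrA; apply: dividesMl.
have tdvd x k : divides N (x * a ^+ k) -> divides t x.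
  move=> h; have : [set x | exists k, divides N (x * a ^+ k)] x by exists k.
  by rewrite ht => -[e _ <-]; exists e.
have [k [s hs]] : [set x | exists k, divides N (x * a ^+ k)] t.
  by rewrite ht; exists 1; rewrite ?mul1r.
have [g hg] : divides t N by apply: (tdvd _ 0); exists 1; rewrite expr0 mulr1 mul1r.
have t0 : t != 0 by apply: contra_neq N0 => t0; rewrite hg t0 mulr0.
exists t, g, k; split; first by rewrite hg mulrC.
  by exists s; apply: (mulfI t0); rewrite hs hg; ring.
have [d [[a' ha] [t' htd] [u [v duv]]]] := pid_gcd a t.
(* The gcd [d] of [a] and [t] is a unit: one more power of [a] supplies the factor [d], so
   [t' = t / d] lies in the saturation and is a multiple of [t]. *)
have [e he] : divides t t'.
  apply: (tdvd _ k.+1); exists (s * a').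
  have -> : t' * a ^+ k.+1 = t' * d * a ^+ k * a'.
    by rewrite exprSr [in RHS]mulrAC {2}ha; ring.
  by rewrite -htd hs; ring.
have de : e * d = 1 by apply: (mulIf t0); rewrite mul1r {2}htd he; ring.
by exists (e * u), (e * v); rewrite -de -duv; ring.
Qed.

(** Replaces an argument on prime divisors: [d] is comaximal with [a], hence with [a ^+ k], which it
    divides. *)
Lemma unit_of_dvd_pow d a k :
  (forall e, divides e d -> divides e a -> e \is a GRing.unit) ->
  divides d (a ^+ k) -> d \is a GRing.unit.
Proof.
move=> h hd; have [e [e1 e2 [u [v huv]]]] := pid_gcd d a.
have ue := h _ e1 e2; apply: (@unit_of_comax_dvd _ (a ^+ k)) => //.
apply/comaxC/comaxX; exists (e^-1 * v), (e^-1 * u).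
by rewrite -(mulVr ue) -{4}huv; ring.
Qed.

End Comaximal.

(** * The twisted action *)

Section TwistedEquivalence.
Variable R : idomainType.
Implicit Types (q : bqform R).

Lemma det_mx2 (A : 'M[R]_2) : \det A = A 0 0 * A 1 1 - A 0 1 * A 1 0.
Proof.
rewrite (expand_det_row _ 0) !big_ord_recl big_ord0 /cofactor !det_mx11 !mxE /=.
have e1 : lift 0 0 = 1 :> 'I_2 by exact: val_inj.
have e0 : lift 1 0 = 0 :> 'I_2 by exact: val_inj.
by rewrite !e1 e0 expr0 expr1; ring.
Qed.

(** Membership in [tw_orbit] with scalar entries and the determinant cleared, so that it amounts to
    polynomial identities. *)
Definition tw_equiv q q' := exists alpha beta gamma delta : R,
  let D := alpha * delta - beta * gamma in
  [/\ D \is a GRing.unit, D * fa q' = feval q alpha gamma,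
      D * fb q' = 2 * fa q * alpha * beta
        + fb q * (alpha * delta + beta * gamma) + 2 * fc q * gamma * delta
    & D * fc q' = feval q beta delta].

Lemma tw_orbitP q q' : tw_orbit q q' <-> tw_equiv q q'.
Proof.
split=> [[A /= uA <-]|[alpha [beta [gamma [delta [uD h1 h2 h3]]]]]].
  exists (A 0 0), (A 0 1), (A 1 0), (A 1 1); rewrite unitmxE in uA.
  by rewrite -det_mx2 /twist /= !mulVKr.
pose A : 'M[R]_2 := \matrix_(i, j) (if i == 0 then if j == 0 then alpha else beta
  else if j == 0 then gamma else delta).
have dA : \det A = alpha * delta - beta * gamma by rewrite det_mx2 !mxE.
exists A; first by rewrite /= unitmxE dA.
rewrite /twist dA !mxE /= -h1 -h2 -h3 !mulKr //.
by case: q' {h1 h2 h3}.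
Qed.

Lemma tw_equiv_refl q : tw_equiv q q.
Proof.
exists 1, 0, 0, 1; have -> : 1 * 1 - 0 * 0 = 1 :> R by ring.
by rewrite /feval; split=> //=; rewrite ?unitr1 //; ring.
Qed.

Lemma tw_equiv_sym q q' : tw_equiv q q' -> tw_equiv q' q.
Proof.
move=> [al [be [ga [de [uD h1 h2 h3]]]]].
have D0 : al * de - be * ga != 0 by apply: contraTneq uD => ->; rewrite unitr0.
(* The adjugate has the same determinant and acts as the inverse, since scalar matrices act
   trivially. *)
exists de, (- be), (- ga), al; rewrite mulrNN [de * al]mulrC; split=> //.
all: apply: (mulfI D0); rewrite /feval.
- transitivity ((al * de - be * ga) * fa q' * de ^+ 2
   - (al * de - be * ga) * fb q' * de * ga
   + (al * de - be * ga) * fc q' * ga ^+ 2); last by ring.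
  by rewrite h1 h2 h3 /feval; ring.
- transitivity (- 2 * ((al * de - be * ga) * fa q') * de * be
   + (al * de - be * ga) * fb q' * (al * de + be * ga)
   - 2 * ((al * de - be * ga) * fc q') * ga * al); last by ring.
  by rewrite h1 h2 h3 /feval; ring.
- transitivity ((al * de - be * ga) * fa q' * be ^+ 2
   - (al * de - be * ga) * fb q' * be * al
   + (al * de - be * ga) * fc q' * al ^+ 2); last by ring.
  by rewrite h1 h2 h3 /feval; ring.
Qed.

Lemma tw_equiv_trans q q' q'' : tw_equiv q q' -> tw_equiv q' q'' -> tw_equiv q q''.
Proof.
move=> [al [be [ga [de [uD h1 h2 h3]]]]] [al' [be' [ga' [de' [uD' h1' h2' h3']]]]].
set D := al * de - be * ga in uD h1 h2 h3.
set D' := al' * de' - be' * ga' in uD' h1' h2' h3'.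
exists (al * al' + be * ga'), (al * be' + be * de'),
  (ga * al' + de * ga'), (ga * be' + de * de').
have -> : (al * al' + be * ga') * (ga * be' + de * de') -
   (al * be' + be * de') * (ga * al' + de * ga') = D * D' by rewrite /D /D'; ring.
split; first by rewrite unitrM uD.
- rewrite -mulrA h1' /feval.
  transitivity (D * fa q' * al' ^+ 2 + D * fb q' * al' * ga' + D * fc q' * ga' ^+ 2).
    by ring.
  by rewrite h1 h2 h3 /feval; ring.
- rewrite -mulrA h2' /feval.
  transitivity (2 * (D * fa q') * al' * be' +
    D * fb q' * (al' * de' + be' * ga') + 2 * (D * fc q') * ga' * de').
    by ring.
  by rewrite h1 h2 h3 /feval; ring.
- rewrite -mulrA h3' /feval.
  transitivity (D * fa q' * be' ^+ 2 + D * fb q' * be' * de' + D * fc q' * de' ^+ 2).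
    by ring.
  by rewrite h1 h2 h3 /feval; ring.
Qed.

Lemma tw_orbit_eq q q' : tw_equiv q q' -> tw_orbit q = tw_orbit q'.
Proof.
move=> e; apply/seteqP; split=> r /tw_orbitP h; apply/tw_orbitP.
  by apply: tw_equiv_trans h; apply: tw_equiv_sym.
exact: tw_equiv_trans h.
Qed.

Lemma tw_equiv_disc q q' : tw_equiv q q' -> disc q' = disc q.
Proof.
move=> [al [be [ga [de [uD h1 h2 h3]]]]].
set D := al * de - be * ga in uD h1 h2 h3.
have uD2 : D ^+ 2 \is a GRing.unit by rewrite unitrX.
apply: (mulrI uD2).
transitivity ((D * fb q') ^+ 2 - 4 * (D * fa q') * (D * fc q')).
  by rewrite /disc; ring.
by rewrite h1 h2 h3 /disc /feval /D; ring.
Qed.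

(** The reversed equivalence writes the coefficients of [q] as combinations of those of [q'], which
    turns a Bezout relation for [q] into one for [q']. *)
Lemma tw_equiv_primitive q q' : tw_equiv q q' -> primitive q -> primitive q'.
Proof.
move=> /tw_equiv_sym[al [be [ga [de [uD h1 h2 h3]]]]] [u [v [w huvw]]].
set D := al * de - be * ga in uD h1 h2 h3.
pose D' := D^-1.
exists (D' * (u * al ^+ 2 + 2 * v * al * be + w * be ^+ 2)),
  (D' * (u * al * ga + v * (al * de + be * ga) + w * be * de)),
  (D' * (u * ga ^+ 2 + 2 * v * ga * de + w * de ^+ 2)).
transitivity (D' * (u * (D * fa q) + v * (D * fb q) + w * (D * fc q))).
  by rewrite h1 h2 h3 /feval; ring.
transitivity (D' * D * (u * fa q + v * fb q + w * fc q)); first by ring.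
by rewrite huvw mulr1 mulVr.
Qed.

Lemma tw_equiv_shift q n :
  tw_equiv q (Form (fa q) (fb q + 2 * fa q * n) (feval q n 1)).
Proof.
exists 1, n, 0, 1; have -> : 1 * 1 - n * 0 = 1 :> R by ring.
by rewrite /feval; split=> //=; rewrite ?unitr1 //; ring.
Qed.

(** A comaximal pair is the first column of a matrix of determinant 1. *)
Lemma tw_equiv_value q x y : comax x y ->
  exists2 q', tw_equiv q q' & fa q' = feval q x y.
Proof.
move=> [u [v h]].
exists (Form (feval q x y) (- 2 * fa q * x * v + fb q * (x * u - v * y)
  + 2 * fc q * y * u) (feval q (- v) u)) => //.
exists x, (- v), y, u.
have -> : x * u - - v * y = 1 by rewrite -h; ring.
by rewrite /feval; split=> //=; rewrite ?unitr1 //; ring.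
Qed.

Hypothesis pidR : is_pid R.

(** Two saturations split a non-unit [N] into factors [t], [t'] and [g'] without any prime
    factorization; the point is then [(t', t)]. *)
Lemma primitive_value q N : primitive q -> N != 0 -> exists x y,
  [/\ comax x y, comax (feval q x y) N & feval q x y != 0].
Proof.
move=> [u [v [w hq]]] N0.
have [uN|nuN] := boolP (N \is a GRing.unit).
  (* Comaximality with a unit is automatic; a nonzero value is found among [a], [c] and
     [a + b + c]. *)
  have cN x : comax x N by apply/comaxC/comax_unit.
  have [a0|a0] := eqVneq (fa q) 0; last first.
    exists 1, 0; split=> //; first exact: comax1.
    by rewrite /feval (_ : _ + _ = fa q) //; ring.
  have [c0|c0] := eqVneq (fc q) 0; last first.
    exists 0, 1; split=> //; first exact/comaxC/comax1.
    by rewrite /feval (_ : _ + _ = fc q) //; ring.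
  exists 1, 1; split=> //; first exact: comax1.
  rewrite /feval a0 c0; apply: contra_eq_neq hq => b0.
  have -> : fb q = 0 by rewrite -b0; ring.
  by rewrite a0 c0 !mulr0 !addr0 eq_sym oner_eq0.
have [t [g [k [hN gk hat]]]] := saturate pidR (fa q) N0.
have g0 : g != 0 by apply: contra_neq N0 => g0; rewrite hN g0 mulr0.
have [t' [g' [l [hg gl hct]]]] := saturate pidR (fc q) g0.
(* A prime divisor of N divides t (and not a), t' (and a but not c) or g'
   (and both a and c, hence not b). *)
have dt' : divides t' (fa q ^+ k).
  by apply: divides_trans gk; exists g'; rewrite hg mulrC.
have dg' : divides g' (fa q ^+ k).
  by apply: divides_trans gk; exists t'; rewrite hg.
have ct : comax t' t by apply: comax_dvdl dt'; apply: comaxX.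
have hV : comax (feval q t' t) N.
  rewrite hN hg; apply: comaxMr; last apply: comaxMr.
  - have -> : feval q t' t = fa q * t' ^+ 2 + (fb q * t' + fc q * t) * t.
      by rewrite /feval; ring.
    by apply: comax_shift; apply: comaxM => //; apply: comaxX.
  - have -> : feval q t' t = fc q * t ^+ 2 + (fb q * t + fa q * t') * t'.
      by rewrite /feval; ring.
    by apply: comax_shift; apply: comaxM => //; apply/comaxX/comaxC.
  - have [d [dV dg [r [s hd]]]] := pid_gcd pidR (feval q t' t) g'.
    suff ud : d \is a GRing.unit.
      exists (d^-1 * r), (d^-1 * s).
      by rewrite -(mulVr ud) -{4}hd; ring.
    (* Two applications leave a common divisor [f] of the value, [a] and [c]; being prime to [t' t],
       it divides [b] and hence 1. *)
    apply: (@unit_of_dvd_pow _ pidR _ (fa q) k); last exact: divides_trans dg'.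
    move=> e ed ea; apply: (@unit_of_dvd_pow _ pidR _ (fc q) l).
      move=> f fe fc_; apply: divides1_unit.
      have fa_ : divides f (fa q) by apply: divides_trans ea.
      have cft : comax f t by exact: comax_dvdl hat fa_.
      have cft' : comax f t' by exact: comax_dvdl hct fc_.
      have fV : divides f (feval q t' t).
        by apply: divides_trans dV; apply: divides_trans ed.
      have fb_ : divides f (fb q).
        apply: (@gauss_comax _ _ (t' * t)); first exact: comaxMr.
        have -> : t' * t * fb q = feval q t' t + (- t' ^+ 2) * fa q
           + (- t ^+ 2) * fc q by rewrite /feval; ring.
        by apply: dividesD; [apply: dividesD => //|]; apply: dividesMl.
      by rewrite -hq; apply: dividesD; [apply: dividesD|]; apply: dividesMl.
    by apply: divides_trans gl; apply: divides_trans dg.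
exists t', t; split=> //.
apply: contraNneq nuN => V0; move: hV; rewrite V0 => hV.
by apply: (@unit_of_comax_dvd _ _ 0); [apply/comaxC | exists 0; rewrite mul0r].
Qed.

Lemma primitive_coprime_coef q N : primitive q -> N != 0 -> exists q',
  [/\ tw_equiv q q', comax (fa q') N & fa q' != 0].
Proof.
move=> /primitive_value h /h[x [y [cxy cN n0]]].
by have [q' e ha] := tw_equiv_value q cxy; exists q'; rewrite ha.
Qed.

Hypothesis two_neq0 : (2 : R) != 0.

Lemma four_neq0 : (4 : R) != 0.
Proof. by rewrite (_ : 4 = 2 * 2) ?mulf_neq0 //; ring. Qed.

(* x/2 is a root of X^2 + p X - m, and principal ideal domains are integrally
   closed. *)
Lemma half_integral (p x m : R) : x ^+ 2 + 2 * p * x = 4 * m -> divides 2 x.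
Proof.
move=> h; have [d [[w hw] [s hs] [u [v hd]]]] := pid_gcd pidR 2 x.
have d0 : d != 0 by apply: contra_neq two_neq0 => d0; rewrite hw d0 mulr0.
have cws : comax w s.
  by exists u, v; apply: (mulIf d0); rewrite mul1r -{2}hd hw hs; ring.
have ws : divides w (s ^+ 2).
  exists (w * m - p * s); apply: (mulIf d0); apply: (mulIf d0).
  transitivity (x ^+ 2); first by rewrite hs; ring.
  transitivity (4 * m - 2 * p * x); first by rewrite -h; ring.
  by rewrite (_ : 4 = 2 * 2); last ring; rewrite hs hw; ring.
have uw : w \is a GRing.unit.
  by apply: unit_of_comax_dvd ws; apply/comaxC/comaxX/comaxC.
exists (s * w^-1); rewrite hw hs mulrA divrK //.
Qed.

(** For [x = b - p] the discriminant gives [x ^ 2 + 2 p x = 4 (a c + t)], so [x] is even. *)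
Lemma disc_half q p t : disc q = p ^+ 2 + 4 * t ->
  exists2 k, fb q = p - 2 * k & fa q * fc q = k ^+ 2 - p * k - t.
Proof.
move=> hd; have [k hk] : divides 2 (fb q - p).
  apply: (@half_integral p _ (fa q * fc q + t)).
  transitivity (disc q + 4 * fa q * fc q - p ^+ 2); first by rewrite /disc; ring.
  by rewrite hd; ring.
have hb : fb q = p - 2 * - k by rewrite -(subrK p (fb q)) hk; ring.
exists (- k) => //; apply: (mulfI four_neq0).
transitivity (fb q ^+ 2 - disc q); first by rewrite /disc; ring.
by rewrite hd hb; ring.
Qed.

End TwistedEquivalence.

(** * Modules and ideals *)

Section ModuleIsomorphisms.
Variable S : comNzRingType.
Implicit Types M N P Q : lmodType S.

Lemma ex_linear M N (f : M -> N) : linear f -> exists F : {linear M -> N}, F =1 f.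
Proof.
move=> lin_f.
pose F : {linear M -> N} := HB.pack f (GRing.isLinear.Build S M N *:%R f lin_f).
by exists F.
Qed.

Lemma ex_bilinear M N P (f : M -> N -> P) :
  (forall n, linear (f^~ n)) -> (forall m, linear (f m)) ->
  exists F : {bilinear M -> N -> P}, forall m n, F m n = f m n.
Proof.
move=> fl fr.
pose F : {bilinear M -> N -> P} :=
  HB.pack f (bilinear_isBilinear.Build S M N P *:%R *:%R f (fl, fr)).
by exists F.
Qed.

Lemma mod_isoP M N : mod_iso M N <->
  exists (f : {linear M -> N}) (g : {linear N -> M}), cancel f g /\ cancel g f.
Proof.
split=> [[f [g fg gf]]|[f [g [fg gf]]]]; last by exists f, g.
have [|G hG] := @ex_linear N M g; last first.
  by exists f, G; split=> x; rewrite !hG.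
by move=> a x y; apply: (can_inj fg); rewrite linearP !gf.
Qed.

Lemma mod_iso_refl M : mod_iso M M.
Proof.
have [|i hi] := @ex_linear M M id; first by move=> a x y.
by exists i; exists id => x; rewrite hi.
Qed.

Lemma mod_iso_sym M N : mod_iso M N -> mod_iso N M.
Proof. by move=> /mod_isoP[f [g [fg gf]]]; apply/mod_isoP; exists g, f. Qed.

Lemma mod_iso_trans M N P : mod_iso M N -> mod_iso N P -> mod_iso M P.
Proof.
move=> [f bf] [g bg]; have [|h hh] := @ex_linear M P (g \o f).
  by move=> a x y; rewrite /= !linearP.
by exists h; apply: eq_bij (bij_comp bg bf) _ _ => x; rewrite hh.
Qed.

(** The universal bilinear map and the maps it induces are conjugated by the three isomorphisms. *)
Lemma is_tensor_iso M N P M' N' P' : mod_iso M M' -> mod_iso N N' ->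
  mod_iso P P' -> is_tensor M N P -> is_tensor M' N' P'.
Proof.
move=> /mod_isoP[f [f' [fK f'K]]] /mod_isoP[g [g' [gK g'K]]].
move=> /mod_isoP[h [h' [hK h'K]]] [beta univ].
have [||beta' hb] := @ex_bilinear M' N' P' (fun m n => h (beta (f' m) (g' n))).
- by move=> n a x y; rewrite /= !linearP linearPl linearP.
- by move=> m a x y; rewrite /= !linearP.
exists beta' => Q gamma.
have [||ga hga] := @ex_bilinear M N Q (fun m n => gamma (f m) (g n)).
- by move=> n a x y; rewrite /= linearP linearPl.
- by move=> m a x y; rewrite /= !linearP.
have [k hk uk] := univ Q ga.
have [|k' hk'] := @ex_linear P' Q (k \o h'); first by move=> a x y; rewrite /= !linearP.
exists k' => [m n|l hl x]; first by rewrite hk' hb /= hK hk hga f'K g'K.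
have [|l' hl'] := @ex_linear P Q (l \o h); first by move=> a x' y; rewrite /= !linearP.
rewrite hk' /= -(uk l'); first by rewrite hl' /= h'K.
by move=> m n; rewrite hl' /= hga -hl hb fK gK.
Qed.

Lemma is_tensor_unique M N P P' :
  is_tensor M N P -> is_tensor M N P' -> mod_iso P P'.
Proof.
move=> [b univ] [b' univ']; have [f hf _] := univ _ b'.
have [g hg _] := univ' _ b; apply/mod_isoP; exists f, g.
(* By uniqueness, an endomorphism fixing a universal bilinear map is the identity; this applies to
   both composites. *)
have end_id Q (c : {bilinear M -> N -> Q}) :
    (forall (R : lmodType S) (ga : {bilinear M -> N -> R}),
      exists2 g : {linear Q -> R}, (forall m n, g (c m n) = ga m n)
      & forall g' : {linear Q -> R}, (forall m n, g' (c m n) = ga m n) -> g' =1 g) ->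
    forall k : {linear Q -> Q}, (forall m n, k (c m n) = c m n) -> k =1 id.
  move=> uni k hk x; have [l _ ul] := uni _ c; rewrite (ul k hk).
  have [|i hi] := @ex_linear Q Q id; first by move=> a y z.
  by rewrite -(ul i) ?hi // => m n; rewrite hi.
split=> x.
- have [|k hk] := @ex_linear P P (g \o f); first by move=> a y z; rewrite /= !linearP.
  by have := end_id _ _ univ k; rewrite -[g (f x)]hk => -> // m n; rewrite hk /= hf.
- have [|k hk] := @ex_linear P' P' (f \o g); first by move=> a y z; rewrite /= !linearP.
  by have := end_id _ _ univ' k; rewrite -[f (g x)]hk => -> // m n; rewrite hk /= hg.
Qed.

End ModuleIsomorphisms.

(** * Ideals with two generators and their tensor products *)

Section IdealModules.
Variable S : comNzRingType.
Implicit Types (u v r s a b : S).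

Lemma span2P u v (z : S) :
  reflect (exists a b, z = a * u + b * v) (z \in span2_pred u v).
Proof. exact: asboolP. Qed.

Lemma span2_val_mem u v (x : span2 u v) : exists a b, (val x : S) = a * u + b * v.
Proof. exact/span2P/(valP x). Qed.

Lemma ex_span2 u v (z : S) : (exists a b, z = a * u + b * v) ->
  exists x : span2 u v, val x = z.
Proof. by move=> /span2P h; exists (Span2 h). Qed.

Lemma span2_valZ u v c (x : span2 u v) : (val (c *: x) : S) = c * val x.
Proof. by rewrite linearZ. Qed.

Lemma span2_valP u v c (x y : span2 u v) : (val (c *: x + y) : S) = c * val x + val y.
Proof. by rewrite linearP. Qed.

(* Two ideals I and J with r I = s J are isomorphic through x |-> (r / s) x. *)
Lemma span2_iso u v u' v' r s : injective ( *%R r) -> injective ( *%R s) ->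
  (forall x : span2 u v, exists y : span2 u' v', r * val x = s * val y) ->
  (forall y : span2 u' v', exists x : span2 u v, r * val x = s * val y) ->
  mod_iso (span2 u v) (span2 u' v').
Proof.
move=> injr injs fwd bwd.
pose f x := sval (cid (fwd x)); have fE x : r * val x = s * val (f x).
  by rewrite /f; case: cid.
pose g y := sval (cid (bwd y)); have gE y : r * val (g y) = s * val y.
  by rewrite /g; case: cid.
have [|F hF] := @ex_linear _ (span2 u v) (span2 u' v') f.
  move=> a x y; apply/val_inj/injs; rewrite /= -fE !span2_valP.
  by rewrite !mulrDr [s * (a * _)]mulrCA -!fE mulrCA.
exists F; exists g => x; rewrite hF.
  by apply/val_inj/injr; rewrite gE -fE.
by apply/val_inj/injs; rewrite -fE gE.
Qed.

(* As p a + q b = 1, every x in <w, a b> is the sum of (p a) x in <w, a><w, b>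
   and of x (q b): this forces the value of the induced map at x. *)
Lemma span2_tensor w a b p q : p * a + q * b = 1 ->
  is_tensor (span2 w a) (span2 w b) (span2 w (a * b)).
Proof.
move=> pq.
have mulP (m : span2 w a) (n : span2 w b) : exists x : span2 w (a * b),
    val x = val m * val n :> S.
  apply: ex_span2; have [c [d ->]] := span2_val_mem m.
  have [c' [d' ->]] := span2_val_mem n.
  by exists (c * c' * w + c * d' * b + d * c' * a), (d * d'); ring.
pose mul m n := sval (cid (mulP m n)).
have mulE m n : val (mul m n) = val m * val n :> S by rewrite /mul; case: cid.
have [||beta hbeta] := @ex_bilinear _ (span2 w a) (span2 w b) _ mul.
- move=> n c x y; apply/val_inj; rewrite !(mulE, span2_valP).
  by rewrite mulrDl mulrA.
- move=> m c x y; apply/val_inj; rewrite !(mulE, span2_valP).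
  by rewrite mulrDr mulrCA.
exists beta => Q gamma.
have inAP (x : span2 w (a * b)) : exists y : span2 w a, val y = val x :> S.
  have [c [d ->]] := span2_val_mem x; apply: ex_span2.
  by exists c, (d * b); ring.
have inBP (x : span2 w (a * b)) : exists y : span2 w b, val y = val x :> S.
  have [c [d ->]] := span2_val_mem x; apply: ex_span2.
  by exists c, (d * a); ring.
pose inA x := sval (cid (inAP x)); pose inB x := sval (cid (inBP x)).
have inAE x : val (inA x) = val x :> S by rewrite /inA; case: cid.
have inBE x : val (inB x) = val x :> S by rewrite /inB; case: cid.
have [A hA] : exists A : span2 w a, val A = p * a.
  by apply: ex_span2; exists 0, p; rewrite mul0r add0r.
have [B hB] : exists B : span2 w b, val B = q * b.
  by apply: ex_span2; exists 0, q; rewrite mul0r add0r.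
have [|g hg] := @ex_linear _ (span2 w (a * b)) Q
    (fun x => gamma A (inB x) + gamma (inA x) B).
  move=> c x y.
  have -> : inB (c *: x + y) = c *: inB x + inB y.
    by apply/val_inj; rewrite !(inBE, span2_valP).
  have -> : inA (c *: x + y) = c *: inA x + inA y.
    by apply/val_inj; rewrite !(inAE, span2_valP).
  by rewrite linearP linearPl scalerDr addrACA.
exists g => [m n|g' hg' x]; last first.
  rewrite hg -!hg' -linearD !hbeta; congr (g' _); apply/val_inj.
  by rewrite linearD /= !mulE inAE inBE hA hB -[val x in LHS]mul1r -pq; ring.
(* Moving [val m] and [val n] across [gamma] turns the two terms of [g] into [p a] and [q b] times
   [gamma m n], and these coefficients sum to 1. *)
have swapA : (val m : S) *: A = (p * a) *: m.
  by apply/val_inj; rewrite !span2_valZ hA mulrC.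
have swapB : (val n : S) *: B = (q * b) *: n.
  by apply/val_inj; rewrite !span2_valZ hB mulrC.
have inB_mul : inB (mul m n) = (val m : S) *: n.
  by apply/val_inj; rewrite inBE mulE span2_valZ.
have inA_mul : inA (mul m n) = (val n : S) *: m.
  by apply/val_inj; rewrite inAE mulE span2_valZ mulrC.
have eA : gamma A (inB (mul m n)) = (p * a) *: gamma m n.
  by rewrite inB_mul linearZr_LR -(linearZl_LR gamma n) swapA linearZl_LR.
have eB : gamma (inA (mul m n)) B = (q * b) *: gamma m n.
  by rewrite inA_mul linearZl_LR -(linearZr_LR gamma m) swapB linearZr_LR.
by rewrite hg hbeta eA eB -scalerDl pq scale1r.
Qed.

End IdealModules.

(** * Ideals of a quadratic order with basis [1], [w] *)

Section QuadraticOrder.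
Variables (R : idomainType) (S : comNzRingType) (io : {rmorphism R -> S}).
Variables (w : S) (p t : R).
Hypothesis w2 : w ^+ 2 + io p * w - io t = 0.
Hypothesis gen_w : forall z : S, exists x y, z = io x + io y * w.
Hypothesis free_w : forall x y, io x + io y * w = 0 -> x = 0 /\ y = 0.
Hypothesis two_neq0 : (2 : R) != 0.

(** Here [k] stands for [(p - b) / 2], so that [w + io k] is [theta] and no division occurs. *)
Definition order_ideal (q : bqform R) (k : R) := span2 (w + io k) (io (fa q)).

(* The second equation says that q has discriminant p ^ 2 + 4 t. *)
Definition half_coef (q : bqform R) (k : R) :=
  fb q = p - 2 * k /\ fa q * fc q = k ^+ 2 - p * k - t.

Lemma free_theta a k x y x' y' : a != 0 ->
  io (a * x) - io y * (w + io k) = io (a * x') - io y' * (w + io k) ->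
  x = x' /\ y = y'.
Proof.
move=> a0 h; have [h1 h2] : a * (x - x') - (y - y') * k = 0 /\ y' - y = 0.
  apply: free_w; transitivity (io (a * x) - io y * (w + io k) -
    (io (a * x') - io y' * (w + io k))); first by ring.
  by rewrite h subrr.
have yy : y = y' by apply/esym/subr0_eq.
split=> //; apply/subr0_eq/(mulfI a0).
by rewrite mulr0 -h1 yy; ring.
Qed.

(** The order may have zero divisors; regularity of scalars comes from freeness over [R]. *)
Lemma io_inj_mul a : a != 0 -> injective ( *%R (io a)).
Proof.
move=> a0 z z'; have [x [y ->]] := gen_w z; have [x' [y' ->]] := gen_w z'.
move=> h; have [h1 h2] : a * (x - x') = 0 /\ a * (y - y') = 0.
  apply: free_w; transitivity (io a * (io x + io y * w) - io a * (io x' + io y' * w)).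
    by ring.
  by rewrite h subrr.
have -> : x = x' by apply/subr0_eq/(mulfI a0); rewrite h1 mulr0.
by have -> : y = y' by apply/subr0_eq/(mulfI a0); rewrite h2 mulr0.
Qed.

Section Coordinates.
Variables (q : bqform R) (k : R).
Hypothesis hk : half_coef q k.

(** Under [half_coef q k], the minus sign makes [a q (x, y)] the norm of this element. *)
Definition coord_elt x y := io (fa q * x) - io y * (w + io k).

Lemma ideal_coord (z : order_ideal q k) : exists x y, val z = coord_elt x y :> S.
Proof.
have [s1 [s2 ->]] := span2_val_mem z; have [x1 [y1 ->]] := gen_w s1.
have [x2 [y2 ->]] := gen_w s2.
(* Obtained by expanding [s1 theta + s2 a] with [w = theta - k] and
   [theta ^ 2 = - b theta - a c]. *)
exists (x2 - y2 * k - y1 * fc q), (- x1 - y1 * (k - p) - fa q * y2).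
apply/subr0_eq; rewrite /coord_elt.
transitivity (io y1 * (w ^+ 2 + io p * w - io t)
  + io (y1 * (fa q * fc q - (k ^+ 2 - p * k - t)))); first by ring.
by rewrite w2 hk.2 subrr !mulr0 rmorph0 addr0.
Qed.

Lemma coord_ideal x y : exists z : order_ideal q k, val z = coord_elt x y :> S.
Proof. by apply: ex_span2; exists (- io y), (io x); rewrite /coord_elt; ring. Qed.

End Coordinates.

Section TwoForms.
Variables (q q' : bqform R) (k k' : R).
Hypotheses (hk : half_coef q k) (hk' : half_coef q' k').
Hypotheses (a0 : fa q != 0) (a0' : fa q' != 0).

Lemma iso_tw_equiv : mod_iso (order_ideal q k) (order_ideal q' k') ->
  tw_equiv q' q.
Proof.
move=> [phi [psi phiK psiK]].
have [A hA] := coord_ideal q k 1 0; have [T hT] := coord_ideal q k 0 1.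
(* The columns of the matrix are the coordinates of the images of [a] and [- theta]. *)
have [al [ga hal]] := ideal_coord hk' (phi A).
have [be [de hbe]] := ideal_coord hk' (phi T).
have comb x y : (val (phi (io x *: A + io y *: T)) : S) =
    coord_elt q' k' (al * x + be * y) (ga * x + de * y).
  rewrite linearP linearZ span2_valP span2_valZ hal hbe /coord_elt; ring.
have surj x' y' : exists x y, al * x + be * y = x' /\ ga * x + de * y = y'.
  have [z hz] := coord_ideal q' k' x' y'.
  have [x [y hxy]] := ideal_coord hk (psi z).
  exists x, y; apply: (@free_theta (fa q') k') => //.
  rewrite -[LHS]comb -[RHS]hz -[in RHS](psiK z); congr (val (phi _)).
  apply/val_inj; rewrite span2_valP span2_valZ hA hT [RHS]hxy /coord_elt; ring.
pose D := al * de - be * ga.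
have uD : D \is a GRing.unit.
  have [x [y [h1 h2]]] := surj 1 0; have [x' [y' [h3 h4]]] := surj 0 1.
  apply: divides1_unit; exists (x * y' - x' * y).
  transitivity ((al * x + be * y) * (ga * x' + de * y')
     - (al * x' + be * y') * (ga * x + de * y)); last by rewrite /D; ring.
  by rewrite h1 h2 h3 h4; ring.
(* Linearity over the order, applied to [(- theta) a = a (- theta)]. Its components on [1] and [w]
   yield the relations between the coefficients. *)
have E : - (w + io k) * coord_elt q' k' al ga = io (fa q) * coord_elt q' k' be de.
  rewrite -hal -hbe -!span2_valZ -!linearZ; congr (val (phi _)).
  apply/val_inj; rewrite !span2_valZ hA hT /coord_elt; ring.
have [E0 E1] : k * fa q' * al - ga * t - k * k' * ga + fa q * fa q' * be
     - fa q * de * k' = 0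
    /\ fa q' * al - ga * (k + k' - p) - fa q * de = 0.
  apply: free_w; transitivity (io (fa q) * coord_elt q' k' be de
    - (- (w + io k) * coord_elt q' k' al ga) + io ga * (w ^+ 2 + io p * w - io t)).
    by rewrite /coord_elt; ring.
  by rewrite E w2 mulr0 subrr addr0.
have E2 : (k - k') * al + ga * fc q' + fa q * be = 0.
  apply: (mulfI a0'); rewrite mulr0.
  transitivity (k * fa q' * al - ga * t - k * k' * ga + fa q * fa q' * be
     - fa q * de * k' - k' * (fa q' * al - ga * (k + k' - p) - fa q * de)
     + ga * (fa q' * fc q' - (k' ^+ 2 - p * k' - t))); first by ring.
  by rewrite E0 E1 hk'.2; ring.
have Da : D * fa q = feval q' al ga.
  apply/subr0_eq; transitivity (- al * (fa q' * al - ga * (k + k' - p) - fa q * de)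
    - ga * ((k - k') * al + ga * fc q' + fa q * be)).
    by rewrite /D /feval hk'.1; ring.
  by rewrite E1 E2; ring.
have Db : D * fb q = 2 * fa q' * al * be + fb q' * (al * de + be * ga)
    + 2 * fc q' * ga * de.
  apply/subr0_eq.
  transitivity (- 2 * be * (fa q' * al - ga * (k + k' - p) - fa q * de)
    - 2 * de * ((k - k') * al + ga * fc q' + fa q * be)).
    by rewrite /D hk.1 hk'.1; ring.
  by rewrite E1 E2; ring.
exists al, be, ga, de; split=> //.
have D0 : D != 0 by apply: contraTneq uD => ->; rewrite unitr0.
(* The last coefficient follows from the other two, because both discriminants equal
   [p ^ 2 + 4 t]. *)
apply: (mulfI (mulf_neq0 (four_neq0 two_neq0) (mulf_neq0 D0 a0))).
transitivity ((D * fb q) ^+ 2 - D ^+ 2 * (fb q ^+ 2 - 4 * (fa q * fc q))).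
  by rewrite /D; ring.
have -> : fb q ^+ 2 - 4 * (fa q * fc q) = fb q' ^+ 2 - 4 * (fa q' * fc q').
  by rewrite hk.2 hk'.2 hk.1 hk'.1; ring.
have -> : 4 * (D * fa q) * feval q' be de = 4 * feval q' al ga * feval q' be de.
  by rewrite Da.
by rewrite Db /feval /D; ring.
Qed.

(** The isomorphism is multiplication by [mu / a], where [mu] is the prescribed image of [a]. It
    needs [mu I = a I'] for the two ideals, together with regularity of [mu] and [a]. *)
Lemma tw_equiv_iso : tw_equiv q' q ->
  mod_iso (order_ideal q k) (order_ideal q' k').
Proof.
move=> [al [be [ga [de [uD Da Db Dc]]]]].
set D := al * de - be * ga in uD Da Db Dc.
have D0 : D != 0 by apply: contraTneq uD => ->; rewrite unitr0.
have DD := mulf_neq0 two_neq0 D0.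
have E1 : fa q' * al - ga * (k + k' - p) - fa q * de = 0.
  apply: (mulfI DD).
  transitivity (2 * D * fa q' * al + ga * (D * (p - 2 * k)) + ga * D * (p - 2 * k')
    - 2 * de * (D * fa q)); first by ring.
  by rewrite -hk.1 -hk'.1 Da Db /D /feval; ring.
have E2 : (k - k') * al + ga * fc q' + fa q * be = 0.
  apply: (mulfI DD).
  transitivity (al * D * (p - 2 * k') - al * (D * (p - 2 * k)) + 2 * D * ga * fc q'
    + 2 * be * (D * fa q)); first by ring.
  by rewrite -hk.1 -hk'.1 Da Db /D /feval; ring.
pose mu := coord_elt q' k' al ga.
have E : - (w + io k) * mu = io (fa q) * coord_elt q' k' be de.
  apply/esym/subr0_eq; rewrite /mu /coord_elt.
  transitivity (io (fa q' * ((k - k') * al + ga * fc q' + fa q * be)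
     + k' * (fa q' * al - ga * (k + k' - p) - fa q * de)
     - ga * (fa q' * fc q' - (k' ^+ 2 - p * k' - t)))
     + io (fa q' * al - ga * (k + k' - p) - fa q * de) * w
     - io ga * (w ^+ 2 + io p * w - io t)); first by ring.
  by rewrite w2 E1 E2 hk'.2 subrr; ring.
have mulE x y : mu * coord_elt q k x y =
    io (fa q) * coord_elt q' k' (al * x + be * y) (ga * x + de * y).
  transitivity (io (fa q * x) * mu + io y * (- (w + io k) * mu)).
    by rewrite /coord_elt; ring.
  by rewrite E /mu /coord_elt; ring.
apply: (@span2_iso _ _ _ _ _ mu (io (fa q))).
(* The left factor is the conjugate of [mu]; the norm [a' q' (al, ga) = a' D a] is a nonzero scalar,
   so [mu] is regular. *)
- have conj : (io (fa q' * al) + io ga * (io (p - 2 * k') + (w + io k'))) * mu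
      = io (fa q' * (D * fa q)).
    apply/subr0_eq; rewrite Da /mu /coord_elt /feval hk'.1.
    transitivity (- io (ga ^+ 2) * (w ^+ 2 + io p * w - io t)
      - io (ga ^+ 2) * io (fa q' * fc q' - (k' ^+ 2 - p * k' - t))).
      by ring.
    by rewrite w2 hk'.2 subrr rmorph0 !mulr0 subr0.
  move=> x y h; apply: (@io_inj_mul (fa q' * (D * fa q))).
    by rewrite !mulf_neq0.
  by rewrite /= -conj -!mulrA h.
- exact: io_inj_mul.
- move=> x; have [X [Y ->]] := ideal_coord hk x.
  by have [y hy] := coord_ideal q' k' (al * X + be * Y) (ga * X + de * Y);
    exists y; rewrite hy mulE.
- move=> y; have [X [Y ->]] := ideal_coord hk' y.
  have [x hx] := coord_ideal q k (D^-1 * (de * X - be * Y)) (D^-1 * (al * Y - ga * X)).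
  exists x; rewrite hx mulE; congr (_ * coord_elt _ _ _ _).
    by rewrite -[RHS](mulKr uD) /D; ring.
  by rewrite -[RHS](mulKr uD) /D; ring.
Qed.

End TwoForms.

Lemma order_ideal_tensor q1 q2 q3 k : comax (fa q1) (fa q2) ->
  fa q3 = fa q1 * fa q2 ->
  is_tensor (order_ideal q1 k) (order_ideal q2 k) (order_ideal q3 k).
Proof.
move=> [u [v huv]] ha; rewrite /order_ideal ha rmorphM.
apply: (@span2_tensor _ _ _ _ (io u) (io v)).
by rewrite -!rmorphM -rmorphD huv rmorph1.
Qed.

End QuadraticOrder.

(** * The class group *)

Lemma exquoE (R : idomainType) (y z : R) : y != 0 -> exquo (y * z) y = z.
Proof. by move=> y0; apply: xget_unique => // x /(mulfI y0). Qed.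

(** * The basis [1], [omega] of [qorder] *)

Section OrderPolynomial.
Variables (R : idomainType) (Delta p t : R).
Hypothesis two_neq0 : (2 : R) != 0.
Hypothesis def_Delta : Delta = p ^+ 2 + 4 * t.

Lemma exquo_disc : exquo (Delta - p ^+ 2) 4 = t.
Proof. by rewrite def_Delta addrC addKr exquoE // four_neq0. Qed.

Local Notation h := (order_poly Delta p).
Local Notation S := (qorder Delta p).

Lemma order_poly_tail : ((size (p *: 'X - t%:P)%R < size ('X^2 : {poly R})%R)%N).
Proof.
rewrite size_polyXn ltnS (leq_trans (size_polyD _ _)) // geq_max.
rewrite (leq_trans (size_scale_leq _ _)) ?size_polyX //=.
by rewrite size_polyN (leq_trans (size_polyC_leq1 _)).
Qed.

Lemma order_polyE : h = 'X^2 + (p *: 'X - t%:P).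
Proof. by rewrite /order_poly exquo_disc addrA. Qed.

Lemma size_order_poly : size h = 3.
Proof. by rewrite order_polyE size_polyDl ?order_poly_tail // size_polyXn. Qed.

Lemma monic_order_poly : h \is monic.
Proof. by rewrite monicE order_polyE lead_coefDl ?order_poly_tail // lead_coefXn. Qed.

(** The quotient is built on [mk_monic h], which falls back on a default modulus unless [h] is monic
    and non-constant. *)
Lemma mk_monic_order_poly : mk_monic h = h.
Proof. by rewrite /mk_monic size_order_poly monic_order_poly. Qed.

Lemma qX_val : ('qX : S) = 'X :> {poly R}.
Proof. by rewrite qpolyXE ?size_order_poly ?monic_order_poly. Qed.

Lemma qX_root :
  ('qX : S) ^+ 2 + in_alg S p * 'qX - in_alg S t = 0.
Proof.
have <- : in_qpoly h h = 0.
  apply/val_inj; rewrite /= mk_monic_order_poly.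
  by rewrite Pdiv.RingMonic.rmodpp ?monic_order_poly.
have -> : in_qpoly h h = in_qpoly h ('X^2 + (p *: 'X - t%:P)).
  by congr (in_qpoly h _); exact: order_polyE.
rewrite rmorphD rmorphXn rmorphB /= in_qpolyZ -alg_polyC in_qpolyZ in_qpoly1.
by rewrite mulr_algl addrA.
Qed.

Lemma qorder_val x y : (in_alg S x + in_alg S y * 'qX : {poly R}) = x%:P + y *: 'X.
Proof.
by rewrite mulr_algl poly_of_qpolyD !poly_of_qpolyZ qX_val /= alg_polyC.
Qed.

Lemma qorder_gen (z : S) : exists x y, z = in_alg S x + in_alg S y * 'qX.
Proof.
exists z`_0, z`_1; apply/npolyP => i; rewrite qorder_val coefD coefC coefZ coefX.
case: i => [|[|i]]; rewrite ?(mulr1, mulr0, addr0, add0r) //=.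
rewrite nth_default // -ltnS (leq_trans (size_mk_monic z)) //.
by rewrite mk_monic_order_poly size_order_poly.
Qed.

Lemma qorder_free x y : in_alg S x + in_alg S y * 'qX = 0 -> x = 0 /\ y = 0.
Proof.
move=> /(congr1 (fun z : S => z : {poly R})); rewrite qorder_val => e.
have e0 i : (x%:P + y *: 'X)`_i = 0 by rewrite e coef0.
have := e0 0%N; have := e0 1%N; rewrite !coefD !coefC !coefZ !coefX /=.
by rewrite mulr0 mulr1 addr0 add0r.
Qed.

End OrderPolynomial.

(** * Classes of forms and their ideal classes *)

Section ClassGroup.
Variables (R : idomainType) (Delta p t : R).
Hypothesis pidR : is_pid R.
Hypothesis two_neq0 : (2 : R) != 0.
Hypothesis def_Delta : Delta = p ^+ 2 + 4 * t.

Local Notation Cl := (Cl_tw Delta p).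
Implicit Types (q : pform Delta) (r : bqform R) (C : Cl).

Lemma pformP q : primitive q /\ disc q = Delta.
Proof. by case: q. Qed.

Lemma pform_half q : exists k, half_coef p t q k.
Proof.
have [_ hq] := pformP q.
by have [k] := disc_half pidR two_neq0 (etrans hq def_Delta); exists k.
Qed.

Lemma pform_tw q r : tw_equiv q r -> exists q' : pform Delta, pform_form q' = r.
Proof.
move=> e; have [pq dq] := pformP q.
have pr := tw_equiv_primitive e pq.
by have dr := tw_equiv_disc e; exists (Pform pr (etrans dr dq)).
Qed.

Lemma form_idealE r k : half_coef p t r k -> form_ideal Delta p r =
  order_ideal (in_alg (qorder Delta p)) 'qX r k.
Proof.
move=> [hb _]; rewrite /form_ideal hb.
by rewrite (_ : p - (p - 2 * k) = 2 * k) ?exquoE //; ring.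
Qed.

Lemma form_ideal_iso q q' : fa q != 0 -> fa q' != 0 ->
  mod_iso (form_ideal Delta p q) (form_ideal Delta p q') <-> tw_equiv q q'.
Proof.
move=> a0 a0'; have [k hk] := pform_half q; have [k' hk'] := pform_half q'.
rewrite (form_idealE hk) (form_idealE hk').
have w2 := qX_root two_neq0 def_Delta; have gen := qorder_gen two_neq0 def_Delta.
have free := qorder_free two_neq0 def_Delta.
split=> h; first exact/tw_equiv_sym/(iso_tw_equiv w2 gen free two_neq0 hk hk').
by apply: (tw_equiv_iso w2 gen free two_neq0 hk hk') => //; exact: tw_equiv_sym.
Qed.

Lemma Cl_eq C C' : orb C = orb C' -> C = C'.
Proof.
case: C C' => [A hA] [B hB] /= AB; case: B / AB hB => hB.
by congr ClTw; exact: Prop_irrelevance.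
Qed.

Lemma cls_eq q q' : tw_equiv q q' -> cls p q = cls p q'.
Proof. by move=> e; apply: Cl_eq; exact: tw_orbit_eq. Qed.

Lemma cls_rep C N : N != 0 ->
  exists q, [/\ C = cls p q, comax (fa q) N & fa q != 0].
Proof.
case: C => A hA N0; have [q hq] := hA; have [pq _] := pformP q.
have [r [e cN a0]] := primitive_coprime_coef pidR pq N0.
have [q' hq'] := pform_tw e; exists q'; rewrite hq'; split=> //.
by apply: Cl_eq; rewrite /= hq hq'; exact: tw_orbit_eq.
Qed.

(** All representatives with nonzero leading coefficient have isomorphic ideals, so their
    isomorphism classes coincide. *)
Lemma to_pic_cls q : fa q != 0 ->
  to_pic (cls p q) = mod_class (form_ideal Delta p q).
Proof.
move=> a0; apply/funext => N; apply/propext; split; last first.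
  by move=> h; exists q; split=> //; apply/tw_orbitP; exact: tw_equiv_refl.
move=> [r [/tw_orbitP e r0 hN]]; have [q' hq'] := pform_tw e.
apply: mod_iso_trans hN; rewrite -hq'; apply/form_ideal_iso; rewrite ?hq' //.
Qed.

Lemma to_pic_inj C C' : to_pic C = to_pic C' -> C = C'.
Proof.
have [q [-> _ a0]] := cls_rep C (oner_neq0 R).
have [q' [-> _ a0']] := cls_rep C' (oner_neq0 R).
rewrite !to_pic_cls // => h; apply/cls_eq/form_ideal_iso => //.
apply: mod_iso_sym; rewrite -[mod_iso _ _]/(mod_class _ _) -h.
exact: mod_iso_refl.
Qed.

(** Dirichlet composition. The class of [q3] satisfies the equation defining [cl_mul], and
    injectivity of [to_pic] makes it the only solution. *)
Lemma cls_mul q1 q2 q3 : fb q1 = fb q3 -> fb q2 = fb q3 ->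
  comax (fa q1) (fa q2) -> fa q3 = fa q1 * fa q2 -> fa q3 != 0 ->
  (cls p q1 * cls p q2)%g = cls p q3.
Proof.
move=> hb1 hb2 cop ha3 a30.
have [a10 a20] : fa q1 != 0 /\ fa q2 != 0.
  by move: a30; rewrite ha3 mulf_eq0 negb_or => /andP[].
have [k hk] := pform_half q3.
have disc_ac q : fb q = fb q3 -> half_coef p t q k.
  have [_ d3] := pformP q3; have [_ dq] := pformP q => hb.
  split; first by rewrite hb hk.1.
  rewrite -hk.2; apply: (mulfI (four_neq0 two_neq0)).
  rewrite !mulrA; apply/oppr_inj/(addrI (fb q ^+ 2)).
  by have := etrans dq (esym d3); rewrite /disc hb.
have tens : is_tensor (form_ideal Delta p q1) (form_ideal Delta p q2)
    (form_ideal Delta p q3).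
  rewrite (form_idealE hk) !(form_idealE (disc_ac _ _)) //.
  exact: order_ideal_tensor.
have e3 : to_pic (cls p q3) = pic_mul (to_pic (cls p q1)) (to_pic (cls p q2)).
  rewrite !to_pic_cls //; apply/funext => P; apply/propext; split=> [h|].
    exists (form_ideal Delta p q1), (form_ideal Delta p q2).
    by split; last apply: is_tensor_iso h tens; exact: mod_iso_refl.
  move=> [M [N [hM hN hP]]]; apply: (is_tensor_unique tens).
  by apply: is_tensor_iso hP; [exact: mod_iso_sym..|exact: mod_iso_refl].
apply: xget_unique => //= C h; apply: to_pic_inj.
by rewrite h e3.
Qed.

End ClassGroup.

(** * The group axioms through composition of forms *)

Section GroupLaws.
Variables (R : idomainType) (Delta p t : R).
Hypothesis pidR : is_pid R.
Hypothesis two_neq0 : (2 : R) != 0.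
Hypothesis Delta_neq0 : Delta != 0.
Hypothesis def_Delta : Delta = p ^+ 2 + 4 * t.

Local Notation Cl := (Cl_tw Delta p).
Implicit Types (q : pform Delta) (C : Cl).

Local Notation cls := (cls p).
Local Notation half q := (half_coef p t q).

Lemma pform_ext q q' : fa q = fa q' -> fb q = fb q' -> fa q != 0 ->
  pform_form q = pform_form q'.
Proof.
move=> ha hb a0; have [_ dq] := pformP q; have [_ dq'] := pformP q'.
have : disc q = disc q' by rewrite dq dq'.
rewrite /disc -ha -hb => /addrI/oppr_inj/mulfI h.
have {h} hc : fc q = fc q' by apply: h; rewrite mulf_neq0 ?four_neq0.
move: ha hb hc; case: (pform_form q) => a b c; case: (pform_form q') => a' b' c'.
by move=> /= -> -> ->.
Qed.

(** A shift fixes [a] and moves [k] within its residue class modulo [a]. *)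
Lemma pform_align q k K : half q k -> divides (fa q) (K - k) ->
  exists q', [/\ tw_equiv q q', fa q' = fa q & fb q' = p - 2 * K].
Proof.
move=> [hb _] [e he]; have [q' hq'] := pform_tw (tw_equiv_shift q (- e)).
exists q'; rewrite hq'; split=> //=; first exact: tw_equiv_shift.
rewrite hb (_ : K = k + e * fa q); first by ring.
by rewrite -he; ring.
Qed.

(** Each leading coefficient is chosen prime to [Delta] and to the earlier ones; the Chinese
    remainder theorem, used twice, then gives a common [K] and so a common [b]. *)
Lemma cls_rep3 C1 C2 C3 : exists q1 q2 q3,
  [/\ C1 = cls q1, C2 = cls q2, C3 = cls q3, fb q1 = fb q3 & fb q2 = fb q3] /\
  [/\ comax (fa q1) (fa q2), comax (fa q1) (fa q3) & comax (fa q2) (fa q3)] /\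
  [/\ comax (fa q1) Delta, comax (fa q2) Delta & comax (fa q3) Delta] /\
  [/\ fa q1 != 0, fa q2 != 0 & fa q3 != 0].
Proof.
have [q1 [-> c1 n1]] := cls_rep pidR C1 Delta_neq0.
have [q2 [-> c2 n2]] := cls_rep pidR C2 (mulf_neq0 n1 Delta_neq0).
have [q3 [-> c3 n3]] := cls_rep pidR C3 (mulf_neq0 n2 (mulf_neq0 n1 Delta_neq0)).
have dvdl (x y : R) : divides x (x * y) by exists y; rewrite mulrC.
have dvdr (x y : R) : divides y (x * y) by exists x.
have c21 := comax_dvdr c2 (dvdl _ _); have c2D := comax_dvdr c2 (dvdr _ _).
have c32 := comax_dvdr c3 (dvdl _ _); have c3' := comax_dvdr c3 (dvdr _ _).
have c31 := comax_dvdr c3' (dvdl _ _); have c3D := comax_dvdr c3' (dvdr _ _).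
have [k1 h1] := pform_half pidR two_neq0 def_Delta q1.
have [k2 h2] := pform_half pidR two_neq0 def_Delta q2.
have [k3 h3] := pform_half pidR two_neq0 def_Delta q3.
have [k12 [d1 d2]] := chinese_comax k1 k2 (comaxC c21).
have c123 : comax (fa q1 * fa q2) (fa q3) by apply: comaxM; exact: comaxC.
have [K [d12 d3]] := chinese_comax k12 k3 c123.
have split_sub (x y : R) : K - x = (K - y) + (y - x) by ring.
have D1 : divides (fa q1) (K - k1).
  by rewrite (split_sub _ k12); apply: dividesD => //; apply: divides_trans d12.
have D2 : divides (fa q2) (K - k2).
  by rewrite (split_sub _ k12); apply: dividesD => //; apply: divides_trans d12.
have [r1 [e1 a1 b1]] := pform_align h1 D1.
have [r2 [e2 a2 b2]] := pform_align h2 D2.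
have [r3 [e3 a3 b3]] := pform_align h3 d3.
exists r1, r2, r3; rewrite a1 a2 a3 b1 b2 b3; split.
  by split=> //; exact: cls_eq.
by do !split=> //; exact: comaxC.
Qed.

(** Equal discriminants give [a1 c1 = a2 c2], so [c1 = a2 c] and [c2 = a1 c]; the composed form is
    [[a1 a2, b, c]]. *)
Lemma pform_compose q1 q2 : fb q1 = fb q2 -> comax (fa q1) (fa q2) ->
  fa q1 != 0 -> fa q2 != 0 ->
  exists q3, fa q3 = fa q1 * fa q2 /\ fb q3 = fb q1.
Proof.
move=> hb cop n1 n2; have [[u [v [w hp1]]] d1] := pformP q1.
have [[u' [v' [w' hp2]]] d2] := pformP q2.
have ac : fa q1 * fc q1 = fa q2 * fc q2.
  apply: (mulfI (four_neq0 two_neq0)).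
  transitivity (fb q1 ^+ 2 - disc q1); first by rewrite /disc; ring.
  transitivity (fb q2 ^+ 2 - disc q2); last by rewrite /disc; ring.
  by rewrite d1 d2 hb.
have [c hc1] : divides (fa q2) (fc q1).
  apply: (@gauss_comax _ _ (fa q1)); first exact: comaxC.
  by exists (fc q2); rewrite ac mulrC.
have hc2 : fc q2 = fa q1 * c by apply: (mulfI n2); rewrite -ac hc1; ring.
have prim : primitive (Form (fa q1 * fa q2) (fb q1) c).
  (* The part [u a1 + w c1] of the first Bezout relation is multiplied by the second relation; every
     term is then a multiple of [a1 a2], [b] or [c]. *)
  exists (u * u'), (v + v' * (u * fa q1 + w * fc q1)),
    (u * fa q1 * w' * fa q1 + w * fa q2 * (u' * fa q2 + w' * fa q1 * c)) => /=.
  transitivity ((u * fa q1 + w * fc q1) * (u' * fa q2 + v' * fb q2 + w' * fc q2)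
    + v * fb q1); first by rewrite hc1 hc2 -hb; ring.
  by rewrite hp2 mulr1 -hp1; ring.
have dsc : disc (Form (fa q1 * fa q2) (fb q1) c) = Delta.
  by apply: etrans d1; rewrite /disc /= hc1; ring.
by exists (Pform prim dsc).
Qed.

Lemma Cl_mulC C1 C2 : (C1 * C2)%g = (C2 * C1)%g.
Proof.
have [q1 [q2 [q3 [[-> -> _ b1 b2] [[c12 _ _] [_ [n1 n2 _]]]]]]] := cls_rep3 C1 C2 C2.
have b12 : fb q1 = fb q2 by rewrite b1 b2.
have [q [ha hb]] := pform_compose b12 c12 n1 n2.
have n : fa q != 0 by rewrite ha mulf_neq0.
rewrite !(@cls_mul _ _ _ _ pidR two_neq0 def_Delta _ _ q) //.
all: by rewrite ?hb -?b12 // 1?mulrC //; exact: comaxC.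
Qed.

(** Both bracketings give the form with leading coefficient [a1 a2 a3] and the common [b]. *)
Lemma Cl_mulA C1 C2 C3 : (C1 * (C2 * C3))%g = (C1 * C2 * C3)%g.
Proof.
have [q1 [q2 [q3 [[-> -> -> b1 b2] [[c12 c13 c23] [_ [n1 n2 n3]]]]]]] :=
  cls_rep3 C1 C2 C3.
have b12 : fb q1 = fb q2 by rewrite b1 b2.
have [q12 [a12 B12]] := pform_compose b12 c12 n1 n2.
have [q23 [a23 B23]] := pform_compose b2 c23 n2 n3.
have n12 : fa q12 != 0 by rewrite a12 mulf_neq0.
have n23 : fa q23 != 0 by rewrite a23 mulf_neq0.
have c : comax (fa q12) (fa q3) by rewrite a12; apply: comaxM.
have c' : comax (fa q1) (fa q23) by rewrite a23; apply: comaxMr.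
have B : fb q12 = fb q3 by rewrite B12.
have [q [a b]] := pform_compose B c n12 n3.
have n : fa q != 0 by rewrite a mulf_neq0.
have mul := @cls_mul _ _ _ _ pidR two_neq0 def_Delta.
rewrite (mul q2 q3 q23) ?(mul q1 q2 q12) ?(mul q12 q3 q) ?(mul q1 q23 q) //.
all: by rewrite ?b ?B23 ?B12 -?b2 -?b1 ?a ?a12 ?a23 ?mulrA.
Qed.

Variable q0 : pform Delta.
Hypothesis q0E : pform_form q0 = Form 1 p (- t).

Lemma half0 : half q0 0.
Proof. by rewrite q0E; split=> /=; ring. Qed.

(** A leading coefficient 1 allows a shift to [k = 0], that is [b = p]; the discriminant then
    determines [c]. *)
Lemma fa1_principal q : fa q = 1 -> cls q = cls q0.
Proof.
move=> a1; have [k hk] := pform_half pidR two_neq0 def_Delta q.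
have [|q' [e a b]] := @pform_align q k 0 hk.
  by exists (0 - k); rewrite a1 mulr1.
rewrite (cls_eq p e); apply: cls_eq.
rewrite (@pform_ext q' q0) ?a ?a1 ?oner_neq0 ?q0E //; first exact: tw_equiv_refl.
by rewrite b /= mulr0 subr0.
Qed.

(** The principal form can be shifted to the middle coefficient of any [q], and 1 is prime to every
    leading coefficient. *)
Lemma Cl_mul1 C : (cls q0 * C)%g = C.
Proof.
have [q [-> _ a0]] := cls_rep pidR C Delta_neq0.
have [k hk] := pform_half pidR two_neq0 def_Delta q.
have [|q' [e a b]] := @pform_align q0 0 k half0.
  by exists (k - 0); rewrite q0E mulr1.
rewrite (cls_eq p e).
have a1 : fa q' = 1 by rewrite a q0E.
apply: (cls_mul pidR two_neq0 def_Delta) => //; rewrite ?a1 ?mul1r //.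
  by rewrite b hk.1.
exact: comax1.
Qed.

(* The form [c, b, a] is inverse to [a, b, c] when a and c are coprime, because
   [ac, b, 1] represents 1. *)
Lemma Cl_mulV C : exists C', (C' * C)%g = cls q0.
Proof.
have [q [-> [u [v huv]] a0]] := cls_rep pidR C Delta_neq0.
have [_ dq] := pformP q.
(* Modulo [a], [1 = v Delta = v b ^ 2], so [q (n, 1) = b n + c = 1]: the shift by [n] makes the last
   coefficient prime to [a]. *)
pose n := v * fb q * (1 - fc q).
have cop m : comax (feval q (n + fa q * m) 1) (fa q).
  exists 1, ((u - 4 * v * fc q) * (1 - fc q) - (n + fa q * m) ^+ 2 - fb q * m).
  transitivity (fc q + (1 - fc q) * (u * fa q + v * disc q)).
    by rewrite /feval /n /disc; ring.
  by rewrite [disc _]dq huv; ring.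
(* This value becomes a leading coefficient and must not vanish. As a quadratic polynomial in [m] it
   has second difference [2 a ^ 3], so it is nonzero at 0, 1 or -1. *)
have [m m0] : exists m, feval q (n + fa q * m) 1 != 0.
  apply: contrapT => no; have f0 m : feval q (n + fa q * m) 1 = 0.
    by apply: contrapT => /eqP ?; apply: no; exists m.
  have : 2 * fa q ^+ 3 = 0.
    transitivity (feval q (n + fa q * 1) 1 + feval q (n + fa q * -1) 1
       - 2 * feval q (n + fa q * 0) 1); first by rewrite /feval; ring.
    by rewrite !f0; ring.
  by apply/eqP; rewrite mulf_neq0 ?expf_neq0.
have [q' hq'] := pform_tw (tw_equiv_shift q (n + fa q * m)).
have e : tw_equiv q q' by rewrite hq'; exact: tw_equiv_shift.
have cq : comax (fc q') (fa q') by rewrite hq'; exact: cop.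
have n1 : fc q' != 0 by rewrite hq'.
have n2 : fa q' != 0 by rewrite hq'.
have [[x [y [z hp]]] d'] := pformP q'.
have prim1 : primitive (Form (fc q') (fb q') (fa q')).
  by exists z, y, x; rewrite /= -hp; ring.
have d1 : disc (Form (fc q') (fb q') (fa q')) = Delta.
  by apply: etrans d'; rewrite /disc /=; ring.
have prim3 : primitive (Form (fc q' * fa q') (fb q') 1).
  by exists 0, 0, 1; rewrite /=; ring.
have d3 : disc (Form (fc q' * fa q') (fb q') 1) = Delta.
  by apply: etrans d'; rewrite /disc /=; ring.
exists (cls (Pform prim1 d1)); rewrite (cls_eq p e).
rewrite (@cls_mul _ _ _ _ pidR two_neq0 def_Delta _ _ (Pform prim3 d3)) //=; last first.
  by rewrite mulf_neq0.
have [s es s1] := @tw_equiv_value _ (Pform prim3 d3) 0 1 (comaxC (comax1 0)).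
have [q'' hs] := pform_tw es; rewrite -hs in es s1.
rewrite (cls_eq p es); apply: fa1_principal.
by rewrite s1 /feval /=; ring.
Qed.

Lemma Cl_abelian : abelian_group_law (cls q0).
Proof. by split; [exact: Cl_mulA|exact: Cl_mulC|exact: Cl_mul1|exact: Cl_mulV]. Qed.

End GroupLaws.

(** * Values modulo the discriminant *)

Section ResidueMap.
Variables (R : comNzRingType) (Delta : R).

(** A name for the projection, to which the ring morphism structure is attached. *)
Definition res (x : R) : residue Delta := \pi_(residue Delta)%qT x.

Lemma res_zmod_morphism : zmod_morphism res.
Proof.
move=> x y; apply: (addIr (res y)); rewrite subrK.
by rewrite -[LHS](@pi_residueD _ Delta) subrK.
Qed.

Lemma res_monoid_morphism : monoid_morphism res.
Proof. by split=> // x y; exact: pi_residueM. Qed.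

HB.instance Definition _ := GRing.isZmodMorphism.Build R (residue Delta) res
  res_zmod_morphism.
HB.instance Definition _ := GRing.isMonoidMorphism.Build R (residue Delta) res
  res_monoid_morphism.

Lemma res_eqP (x y : R) : (exists a, x - y = a * Delta) <-> res x = res y.
Proof. exact: residue_eqP. Qed.

Lemma res_Delta : res Delta = 0.
Proof.
by rewrite -(rmorph0 res); apply/res_eqP; exists 1; rewrite subr0 mul1r.
Qed.

Lemma res_surj (z : residue Delta) : exists x, z = res x.
Proof. by exists (repr z); rewrite /res reprK. Qed.

Lemma feval_res (q : bqform R) x y :
  feval (map_form \pi_(residue Delta)%qT q) (res x) (res y) = res (feval q x y).
Proof. by rewrite /feval !(rmorphD, rmorphM, rmorphXn). Qed.

Lemma units_mulC (u v : units (residue Delta)) : (u * v)%g = (v * u)%g.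
Proof. by apply/val_inj; exact: mulrC. Qed.

Lemma units_abelian : abelian_group_law (1%g : units (residue Delta)).
Proof.
split=> [x y z|||x]; [exact: mulgA | exact: units_mulC | exact: mul1g |].
by exists (x^-1)%g; exact: mulVg.
Qed.

End ResidueMap.

(** * Value sets as cosets of [H0] *)

Section Values.
Variables (R : idomainType) (Delta p t : R).

Local Notation U := (units (residue Delta)).
Local Notation res := (res Delta).
Implicit Types (q : bqform R) (u : U).

Lemma comax_unit_res a : comax a Delta -> exists2 u : U, val u = res a
  & exists a', res a' * res a = 1.
Proof.
move=> [a' [b h]]; have ha' : res a' * res a = 1.
  by rewrite -(rmorph1 res) -h rmorphD !rmorphM /= res_Delta mulr0 addr0.
have ua : is_unit (res a) by apply/asboolP; exists (res a').
by exists (Units ua) => //; exists a'.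
Qed.

(** The linear substitution is absorbed into the arguments, and only the inverse of the determinant
    remains, as the unit [e]. *)
Lemma mem_H q u : H_ Delta q u <->
  exists e x y, e \is a GRing.unit /\ val u = res (e * feval q x y).
Proof.
split=> [[q' /tw_orbitP[al [be [ga [de [uD h1 h2 h3]]]]] [x [y hu]]]|].
  have [x' hx] := res_surj x; have [y' hy] := res_surj y.
  exists (al * de - be * ga)^-1, (al * x' + be * y'), (ga * x' + de * y').
  rewrite unitrV; split=> //; rewrite /= hu hx hy feval_res; congr res.
  apply: (mulrI uD); rewrite mulVKr //.
  transitivity ((al * de - be * ga) * fa q' * x' ^+ 2
    + (al * de - be * ga) * fb q' * x' * y' + (al * de - be * ga) * fc q' * y' ^+ 2).
    by rewrite /feval; ring.
  by rewrite h1 h2 h3 /feval; ring.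
move=> [e [x [y [ue hu]]]].
(* The image of [q] under the diagonal matrix [(e^-1, 1)]; at [(e x, y)] it takes the value
   [e q (x, y)]. *)
exists (Form (e^-1 * fa q) (fb q) (e * fc q)).
  apply/tw_orbitP; exists e^-1, 0, 0, 1; rewrite mulr1 mul0r subr0.
  split; rewrite ?unitrV // /feval /=.
  - by ring.
  - by ring.
  - by rewrite mulKr //; ring.
exists (res (e * x)), (res y); rewrite [LHS]hu -/(map_form _ _) feval_res; congr res.
rewrite /feval /=.
transitivity (e * e^-1 * e * fa q * x ^+ 2 + e * fb q * x * y + e * fc q * y ^+ 2).
  by rewrite mulrV //; ring.
by ring.
Qed.

Local Notation q0 := (Form 1 p (- t)).
Local Notation H0 := (H_ Delta q0).

(* q0 (x, y) is the norm of x - omega y. *)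
Lemma principal_mul x y x' y' : feval q0 x y * feval q0 x' y' =
  feval q0 (x * x' + t * y * y') (x * y' + x' * y + p * y * y').
Proof. by rewrite /feval /=; ring. Qed.

Lemma H0_subgroup : is_subgroup (1%g : U) H0.
Proof.
have H0M x y : H0 x -> H0 y -> H0 (x * y)%g.
  move=> /mem_H[e [a [b [ue hx]]]] /mem_H[e' [a' [b' [ue' hy]]]].
  apply/mem_H; exists (e * e'), (a * a' + t * b * b'), (a * b' + a' * b + p * b * b').
  rewrite unitrM ue ue'; split=> //.
  by rewrite -principal_mul mulrACA rmorphM /= -hx -hy.
split=> //.
  apply/mem_H; exists 1, 1, 0; rewrite unitr1; split=> //.
  by rewrite mul1r /feval /= (_ : _ + _ = 1) ?rmorph1 //; ring.
move=> x /mem_H[e [a [b [ue hx]]]]; exists (x^-1)%g; last exact: mulVg.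
(* x^-1 = x (x^-1)^2 *)
have [v hv] := res_surj (val (x^-1)%g).
have vx : res v * val x = 1 by rewrite -hv; exact: unit_invP.
apply/mem_H; exists e, (v * a), (v * b); split=> //.
have -> : e * feval q0 (v * a) (v * b) = v * (v * (e * feval q0 a b)).
  by rewrite /feval; ring.
by rewrite rmorphM /= rmorphM /= -hx vx mulr1 -hv.
Qed.

(** Both sides are the norm of [a x - theta y]. *)
Lemma form_principal q k x y : half_coef p t q k ->
  fa q * feval q x y = feval q0 (fa q * x - k * y) y.
Proof.
move=> [hb hac]; rewrite /feval /= hb.
transitivity (fa q ^+ 2 * x ^+ 2 + fa q * (p - 2 * k) * x * y + fa q * fc q * y ^+ 2).
  by ring.
by rewrite hac; ring.
Qed.

(* a q(x, y) = q0(a x - k y, y), and (x, y) |-> (a x - k y, y) is bijective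
   modulo Delta when a is coprime to Delta. *)
Lemma H_coset q k u : half_coef p t q k -> comax (fa q) Delta ->
  val u = res (fa q) -> H_ Delta q = coset_set H0 u.
Proof.
move=> hk /comax_unit_res[_ _ [a' ha']] hu; apply/seteqP; split=> v.
  move=> /mem_H[e [x [y [ue hv]]]]; exists (u^-1 * v)%g; last first.
    by rewrite mulgA mulgV mul1g.
  (* Scaling both arguments by [a'] multiplies the value by [a' ^ 2]; as [a' a = 1] modulo [Delta],
     this gives [a' e q (x, y)], the residue of [u^-1 v]. *)
  apply/mem_H; exists e, (a' * (fa q * x - k * y)), (a' * y); split=> //.
  have -> : e * feval q0 (a' * (fa q * x - k * y)) (a' * y) =
      a' * fa q * (a' * (e * feval q x y)).
    transitivity (e * a' ^+ 2 * feval q0 (fa q * x - k * y) y).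
      by rewrite /feval; ring.
    by rewrite -(form_principal _ _ hk); ring.
  rewrite rmorphM /= [res (a' * fa q)]rmorphM ha' mul1r rmorphM /= -hv.
  have -> : val v = val u * val (u^-1 * v)%g :> residue Delta.
    by rewrite -[RHS]/(val (u * (u^-1 * v))%g) mulgA mulgV mul1g.
  by rewrite hu mulrA ha' mul1r.
move=> [h /mem_H[e [X [Y [ue hh]]]] <-].
(* The solution of [a x - k Y = X] modulo [Delta]. Evaluation at [(a x, a Y)] brings out [a ^ 2]:
   one factor converts [q] into [q0], the other is [u]. *)
pose x := a' * (X + k * Y).
apply/mem_H; exists e, (fa q * x), (fa q * Y); split=> //.
have -> : e * feval q (fa q * x) (fa q * Y) =
    fa q * (e * feval q0 (fa q * x - k * Y) Y).
  by rewrite -(form_principal _ _ hk) /feval; ring.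
rewrite rmorphM /= -hu -[LHS]/(val u * val h) hh; congr (_ * _).
have hX : res X = res (fa q * x - k * Y).
  rewrite rmorphB /x !rmorphM /= mulrA [res (fa q) * _]mulrC ha' mul1r.
  by rewrite rmorphD rmorphM /= addrK.
by rewrite !rmorphM /= -!feval_res hX.
Qed.

End Values.

(** * Quotients of abelian groups *)

Section Cosets.
Variables (G : magmaType) (e : G) (H : set G).
Hypothesis groupG : abelian_group_law e.
Hypothesis subH : is_subgroup e H.
Local Open Scope group_scope.

Lemma quotg_eq (A B : quotg H) : quotg_set A = quotg_set B -> A = B.
Proof.
case: A B => [A hA] [B hB] /= AB; case: B / AB hB => hB.
by congr Quotg; exact: Prop_irrelevance.
Qed.

Lemma coset_setM x h : H h -> coset_set H (x * h) = coset_set H x.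
Proof.
have [mA mC m1 _] := groupG; have [_ HM HV] := subH => Hh.
apply/seteqP; split=> _ [k Hk <-].
  by exists (h * k); [exact: HM | exact: mA].
have [h' Hh' h'h] := HV h Hh; exists (h' * k); first exact: HM.
by rewrite -mA (mA h) (mC h) h'h m1.
Qed.

Lemma coset_repr x : exists2 h, H h & quotg_repr (coset_proj H x) = x * h.
Proof.
have [_ mC m1 _] := groupG; have [H1 _ _] := subH.
rewrite /quotg_repr; case: cid => y /= yP.
have : coset_set H y y by exists e; rewrite // mC m1.
by rewrite -yP => -[h Hh <-]; exists h.
Qed.

Lemma coset_projM x y : coset_proj H x * coset_proj H y = coset_proj H (x * y).
Proof.
have [mA mC _ _] := groupG; have [_ HM _] := subH.
have [h Hh hx] := coset_repr x; have [k Hk hy] := coset_repr y.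
apply: quotg_eq; rewrite /= hx hy.
have -> : x * h * (y * k) = x * y * (h * k).
  by rewrite -mA (mA h) (mC h) -mA mA.
by rewrite coset_setM //; exact: HM.
Qed.

Lemma coset_proj_surj (A : quotg H) : exists x, A = coset_proj H x.
Proof. by case: A => A hA; have [x hx] := hA; exists x; exact: quotg_eq. Qed.

(** A chosen representative of a coset is known only up to a factor in [H], which [f] ignores. *)
Lemma quotg_factor (K : magmaType) (f : {multiplicative G -> K}) :
  (forall x h, H h -> f (x * h) = f x) ->
  exists F : {multiplicative quotg H -> K}, forall x, F (coset_proj H x) = f x.
Proof.
move=> fH; pose g (A : quotg H) := f (quotg_repr A).
have gE x : g (coset_proj H x) = f x.
  by rewrite /g; have [h Hh ->] := coset_repr x; exact: fH.
have gM : {morph g : A B / A * B}.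
  move=> A B; have [x ->] := coset_proj_surj A; have [y ->] := coset_proj_surj B.
  by rewrite coset_projM !gE gmulfM.
pose F : {multiplicative quotg H -> K} :=
  HB.pack g (isMultiplicative.Build (quotg H) K g gM).
by exists F.
Qed.

Lemma squares_subgroup : is_subgroup e (@squares G).
Proof.
have [mA mC m1 mV] := groupG.
have mACA (x y z w : G) : x * y * (z * w) = x * z * (y * w).
  by rewrite -mA (mA y) (mC y) -mA mA.
split; first by exists e.
  by move=> _ _ [x _ <-] [y _ <-]; exists (x * y); rewrite // mACA.
move=> _ [x _ <-]; have [y yx] := mV x.
by exists (y * y); [exists y | rewrite mACA yx m1].
Qed.

End Cosets.

(** * The homomorphism [psi] and its factorization *)

Theorem theorem3p8 (R : idomainType) (pidR : is_pid R)
  (char_neq2 : 2%N \notin [pchar R])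
  (Delta : R) (Delta_neq0 : Delta != 0)
  (pi : R) (Delta_pi : exists t, Delta = pi ^+ 2 + 4 * t) :
  let Cl := Cl_tw Delta pi in
  let U := units (residue Delta) in
  let q0 := principal_form Delta pi in
  let H0 : set U := H_ Delta q0 in
  exists e : Cl,
    [/\ orb e = tw_orbit q0,
        abelian_group_law e,
        is_subgroup (1%g : U) H0
      & exists psi : {multiplicative Cl -> (U //g H0)},
        [/\ forall q : pform Delta, quotg_set (psi (cls pi q)) = H_ Delta q,
            is_subgroup e squares,
            forall C : Cl, squares C -> psi C = coset_proj H0 1%g
          & exists Psi : {multiplicative (Cl //g squares) -> (U //g H0)},
            forall C : Cl, Psi (coset_proj squares C) = psi C]].
Proof.
move=> Cl U q0 H0.
have two_neq0 : (2 : R) != 0.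
  by apply: contraNneq char_neq2 => h; rewrite inE /= h eqxx.
have [t def_Delta] := Delta_pi.
have q0E : q0 = Form 1 pi (- t).
  by rewrite /q0 /principal_form (exquo_disc two_neq0 def_Delta).
have prim0 : primitive q0 by exists 1, 0, 0; rewrite q0E /=; ring.
have disc0 : disc q0 = Delta by rewrite q0E [RHS]def_Delta /disc /=; ring.
pose f0 := Pform prim0 disc0.
have f0E : pform_form f0 = Form 1 pi (- t) := q0E.
have groupCl := Cl_abelian pidR two_neq0 Delta_neq0 def_Delta f0E.
have groupU := units_abelian Delta.
have subH0 : is_subgroup (1%g : U) H0.
  by rewrite /H0 q0E; exact: H0_subgroup.
have coset_mul1 (A : U //g H0) : (A * coset_proj H0 1)%g = A.
  by have [u ->] := coset_proj_surj A; rewrite (coset_projM groupU subH0) mulg1.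
have cosetH (q : pform Delta) (u : U) : comax (fa q) Delta ->
    val u = res Delta (fa q) -> H_ Delta q = coset_set H0 u.
  have [k hk] := pform_half pidR two_neq0 def_Delta q => cop hu.
  by rewrite /H0 q0E; exact: (H_coset hk).
(* Taken over the whole orbit, this set involves no choice of representative; well-definedness of
   [psi] reduces to its being a coset. *)
pose HC (C : Cl) : set U := \bigcup_(r in orb C) values Delta r.
have HCP C : exists u : U, HC C = coset_set H0 u.
  have [q [-> cop _]] := cls_rep pidR C Delta_neq0.
  by have [u hu _] := comax_unit_res cop; exists u; exact: cosetH.
pose psi0 (C : Cl) : U //g H0 := Quotg (HCP C).
have psi0E (q : pform Delta) (u : U) : comax (fa q) Delta ->
    val u = res Delta (fa q) -> psi0 (cls pi q) = coset_proj H0 u.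
  by move=> cop hu; apply: quotg_eq; exact: cosetH.
(* The composed form has leading coefficient [a1 a2], again prime to [Delta], and [psi0] is the
   coset of such a coefficient. *)
have psi0M : {morph psi0 : C D / (C * D)%g}.
  move=> C D.
  have [q1 [q2 [q3 [[-> -> _ b1 b2] [[c12 _ _] [[c1 c2 _] [n1 n2 _]]]]]]] :=
    cls_rep3 pidR two_neq0 Delta_neq0 def_Delta C D D.
  have b12 : fb q1 = fb q2 by rewrite b1 b2.
  have [q [ha hb]] := pform_compose two_neq0 b12 c12 n1 n2.
  have [u1 hu1 _] := comax_unit_res c1; have [u2 hu2 _] := comax_unit_res c2.
  rewrite (cls_mul pidR two_neq0 def_Delta (q3 := q)) ?hb ?ha ?mulf_neq0 //.
  rewrite (psi0E q1 u1) // (psi0E q2 u2) // (coset_projM groupU subH0).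
  apply: psi0E; first by rewrite ha; exact: comaxM.
  by rewrite ha rmorphM /= -hu1 -hu2.
pose psi : {multiplicative Cl -> (U //g H0)} :=
  HB.pack psi0 (isMultiplicative.Build Cl (U //g H0) psi0 psi0M).
have psi_sq C : squares C -> psi C = coset_proj H0 1%g.
  move=> [D _ <-]; rewrite gmulfM.
  have [q [-> cop _]] := cls_rep pidR D Delta_neq0.
  have [u hu _] := comax_unit_res cop.
  rewrite -[psi _]/(psi0 _) (psi0E q u) // (coset_projM groupU subH0).
  rewrite -[X in coset_proj H0 X]mul1g; apply: quotg_eq.
  apply: (coset_setM groupU subH0); rewrite /H0 q0E; apply/mem_H.
  (* The square of the leading coefficient is the value [q0 (a, 0)]. *)
  exists 1, (fa q), 0; rewrite unitr1; split=> //.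
  rewrite -[LHS]/(val u * val u) hu -rmorphM; congr (res Delta _).
  by rewrite /feval /=; ring.
exists (cls pi f0); split=> //.
exists psi; split=> //.
- exact: squares_subgroup.
- have sub := squares_subgroup groupCl.
  have [|Psi hPsi] := @quotg_factor Cl _ _ groupCl sub _ psi; last by exists Psi.
  move=> C D sqD; rewrite gmulfM (psi_sq D) //.
  exact: coset_mul1.
Qed.
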